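(* Let $d\in\mathbb{N}$ and let $F\in GL_d(\mathbb{C})$ be a non-generic matrix, i.e. the eigenvalues of $F^*F$ are not pairwise distinct (so in particular $d\ge2$). Then the compact quantum group $U_F^+$ (i.e. the augmented algebra $(\mathrm{Pol}(U_F^+),\epsilon)$) has none of the properties (GC), (NC) and (LK).
   Context: For a matrix $a=(a_{jk})$ over a $^*$-algebra, $a^t=(a_{kj})$, $\bar a=(a_{jk}^* )$, $a^*=\bar a^t$. $\mathrm{Pol}(U_F^+)$ is the universal unital $^*$-algebra generated by $u_{jk}$, $1\le j,k\le d$, subject to the relations that $u=(u_{jk})$ is unitary ($uu^*=u^*u=I$) and $F\bar uF^{-1}$ is unitary. Its character (counit) $\epsilon$ is the unital $^*$-homomorphism to $\mathbb{C}$ with $\epsilon(u_{jk})=\delta_{jk}$. Let $A$ be a unital $^*$-algebra with a character $\epsilon$, generated as a $^*$-algebra by the entries of a unitary matrix. Inner products are linear in the second argument; a representation on a Hilbert space $H$ means a unital $^*$-representation $\rho:A\to B(H)$. A $\rho$-$\epsilon$-cocycle is a linear map $\eta:A\to H$ with $\eta(ab)=\rho(a)\eta(b)+\eta(a)\epsilon(b)$. A Schürmann triple is $(\rho,\eta,\psi)$ with $\rho$ a representation, $\eta$ a $\rho$-$\epsilon$-cocycle and $\psi:A\to\mathbb{C}$ linear with $\psi(ab)=\psi(a)\epsilon(b)+\epsilon(a)\psi(b)+\langle\eta(a^* ),\eta(b)\rangle$ for all $a,b\in A$. A cocycle $\eta$ is Gaussian if $\rho=\epsilon(\cdot)\,\mathrm{id}_H$.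 For a representation $\rho$ on $H$ put $H_G=\{\xi\in H:\rho(a)\xi=\epsilon(a)\xi\ \forall a\in A\}$. A generating functional is a linear $\psi:A\to\mathbb{C}$ with $\psi(1)=0$, $\psi(a^* )=\overline{\psi(a)}$ and $\psi(a^*a)\ge0$ for $a\in\ker\epsilon$. Every generating functional $\psi$ is part of a Schürmann triple $(\rho,\eta,\psi)$ with $\eta(A)$ dense in $H$, unique up to unitary equivalence (the associated triple). With $P_G$ the orthogonal projection onto $H_G$, put $\rho_G=\rho|_{H_G}$, $\rho_N=\rho|_{H_G^\perp}$, $\eta_G=P_G\eta$, $\eta_N=(I-P_G)\eta$. One says $\psi$ admits a Lévy–Khintchine decomposition if there exist generating functionals $\psi_G,\psi_N$ such that $(\rho_G,\eta_G,\psi_G)$ and $(\rho_N,\eta_N,\psi_N)$ are Schürmann triples. Property (LK): every generating functional on $(A,\epsilon)$ admits a Lévy–Khintchine decomposition. Property (GC): every Gaussian cocycle $\eta:A\to H$ (any Hilbert space $H$) can be completed to a Schürmann triple $(\epsilon(\cdot)\mathrm{id},\eta,\psi)$. Property (NC): every pair $(\rho,\eta)$ of a representation $\rho:A\to B(H)$ with $H_G=\{0\}$ and a $\rho$-$\epsilon$-cocycle $\eta:A\to H$ can be completed to a Schürmann triple $(\rho,\eta,\psi)$. *)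

(* Defs.v *)
From HB Require Import structures.
From mathcomp Require Import all_boot all_order all_algebra.
From mathcomp Require Import boolp classical_sets reals complex ring lra.

Set Implicit Arguments.
Unset Strict Implicit.
Unset Printing Implicit Defensive.

Import Order.TTheory GRing.Theory Num.Theory.
Local Open Scope ring_scope.
Local Open Scope quotient_scope.

HB.mixin Record hasStar (C : numClosedFieldType) A of GRing.Algebra C A := {
  star : A -> A;
  starK : involutive star;
  starM : forall a b, star (a * b) = star b * star a;
  starP : forall (c : C) a b, star (c *: a + b) = c^* *: star a + star b
}.

#[short(type="starAlgType")]
HB.structure Definition StarAlgebra (C : numClosedFieldType) :=
  {A of GRing.Algebra C A & hasStar C A}.

Record starMorphism (C : numClosedFieldType) (A B : starAlgType C) :=
  StarMorphism {
    star_morphism_fun :> {lrmorphism A -> B};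
    star_morphismP : forall a,
      star_morphism_fun (star a) = star (star_morphism_fun a)
  }.

Section Scalars.
Variable C : numClosedFieldType.

Fact regular_starM (a b : C^o) : (a * b)^* = b^* * a^* :> C^o.
Proof. by rewrite rmorphM mulrC. Qed.

Fact regular_starP (c : C) (a b : C^o) :
  (c *: a + b)^* = c^* *: (a^* : C^o) + b^* :> C^o.
Proof. by rewrite rmorphD rmorphM. Qed.

HB.instance Definition _ := @hasStar.Build C C^o (fun c : C => c^*)
  (@conjCK C) regular_starM regular_starP.
End Scalars.

Definition character (C : numClosedFieldType) (A : starAlgType C) :=
  starMorphism A C^o.

Section StarMatrices.
Variables (C : numClosedFieldType) (A : starAlgType C) (d : nat).

Definition bar_mx (a : 'M[A]_d) : 'M[A]_d := map_mx (@star C A) a.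
Definition adj_mx (a : 'M[A]_d) : 'M[A]_d := (bar_mx a)^T.
Definition unitary_mx (a : 'M[A]_d) : Prop :=
  a *m adj_mx a = 1%:M /\ adj_mx a *m a = 1%:M.
Definition scalars_mx (F : 'M[C]_d) : 'M[A]_d := map_mx (fun c => c%:A) F.

Definition UF_relations (F : 'M[C]_d) (v : 'M[A]_d) : Prop :=
  unitary_mx v /\
  unitary_mx (scalars_mx F *m bar_mx v *m scalars_mx (invmx F)).
End StarMatrices.

Section Pol.
Variables (C : numClosedFieldType) (d : nat).

Inductive starTerm : Type :=
| TGen of 'I_d & 'I_d
| TConst of C
| TAdd of starTerm & starTerm
| TMul of starTerm & starTerm
| TStar of starTerm.

HB.instance Definition _ := gen_eqMixin starTerm.
HB.instance Definition _ := gen_choiceMixin starTerm.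

Fixpoint teval (B : starAlgType C) (v : 'M[B]_d) (t : starTerm) : B :=
  match t with
  | TGen j k => v j k
  | TConst c => c%:A
  | TAdd s t => teval v s + teval v t
  | TMul s t => teval v s * teval v t
  | TStar s => star (teval v s)
  end.

Variables (F : 'M[C]_d) (Fu : F \in unitmx).

(* Two *-polynomials in the u_jk are identified iff they take the same value at
   every matrix, over every unital *-algebra, that satisfies the relations:
   the quotient is the algebra presented by these relations (see [pol_liftE]
   and [pol_morphism_eq] for the universal property). *)
Definition pol_eqv (s t : starTerm) : bool :=
  `[< forall (B : starAlgType C) (v : 'M[B]_d),
        UF_relations F v -> teval v s = teval v t >].

Fact pol_eqv_equiv : equiv_class_of pol_eqv.
Proof.
split.
- by move=> s; apply/asboolP.
- by move=> s t; apply/idP/idP => /asboolP h; apply/asboolP => B v hv;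
    rewrite h.
- move=> s t r /asboolP h1 /asboolP h2; apply/asboolP => B v hv.
  by rewrite h1 ?h2.
Qed.

Canonical pol_eqv_rel := EquivRelPack pol_eqv_equiv.

(* [Fu] only records that F is invertible, so that the algebra is nonzero. *)
Definition Pol of (F \in unitmx) : Type := {eq_quot pol_eqv_rel}.
Local Notation P := (Pol Fu).

HB.instance Definition _ := Choice.on P.
HB.instance Definition _ := EqQuotient.on P.

Definition pol_of (t : starTerm) : P := \pi_P t.

Lemma pol_ofP (s t : starTerm) :
  pol_of s = pol_of t <-> forall (B : starAlgType C) (v : 'M[B]_d),
    UF_relations F v -> teval v s = teval v t.
Proof.
split; first by move=> /eqmodP /asboolP.
by move=> h; apply/eqmodP/asboolP.
Qed.

Lemma teval_repr (t : starTerm) (B : starAlgType C) (v : 'M[B]_d) :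
  UF_relations F v -> teval v (repr (pol_of t)) = teval v t.
Proof. by move=> hv; apply: (pol_ofP _ _).1 => //; rewrite /pol_of reprK. Qed.

Definition pol_zero : P := pol_of (TConst 0).
Definition pol_one : P := pol_of (TConst 1).
Definition pol_add (a b : P) : P := pol_of (TAdd (repr a) (repr b)).
Definition pol_mul (a b : P) : P := pol_of (TMul (repr a) (repr b)).
Definition pol_scale (c : C) (a : P) : P := pol_of (TMul (TConst c) (repr a)).
Definition pol_opp (a : P) : P := pol_scale (-1) a.
Definition pol_star (a : P) : P := pol_of (TStar (repr a)).

Lemma pol_ext (a b : P) :
  (forall (B : starAlgType C) (v : 'M[B]_d),
    UF_relations F v -> teval v (repr a) = teval v (repr b)) -> a = b.
Proof. by move=> h; rewrite -[a]reprK -[b]reprK; apply/pol_ofP. Qed.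

Ltac pol_tac := repeat intro; apply: pol_ext => B0 v0 hv0;
  rewrite /pol_opp /pol_add /pol_mul /pol_scale /pol_star /pol_zero /pol_one;
  rewrite ?teval_repr //= ?teval_repr //= ?teval_repr //=.

Fact pol_addA : associative pol_add.
Proof. by pol_tac; rewrite addrA. Qed.
Fact pol_addC : commutative pol_add.
Proof. by pol_tac; rewrite addrC. Qed.
Fact pol_add0 : left_id pol_zero pol_add.
Proof. by pol_tac; rewrite scale0r add0r. Qed.
Fact pol_addN : left_inverse pol_zero pol_opp pol_add.
Proof. by pol_tac; rewrite mulr_algl scaleN1r addNr scale0r. Qed.

HB.instance Definition _ :=
  GRing.isZmodule.Build P pol_addA pol_addC pol_add0 pol_addN.

Fact pol_mulA : associative pol_mul.
Proof. by pol_tac; rewrite mulrA. Qed.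
Fact pol_mul1 : left_id pol_one pol_mul.
Proof. by pol_tac; rewrite scale1r mul1r. Qed.
Fact pol_mulr1 : right_id pol_one pol_mul.
Proof. by pol_tac; rewrite scale1r mulr1. Qed.
Fact pol_mulDl : left_distributive pol_mul +%R.
Proof.
rewrite /GRing.add /=; pol_tac; exact: mulrDl.
Qed.
Fact pol_mulDr : right_distributive pol_mul +%R.
Proof.
rewrite /GRing.add /=; pol_tac; exact: mulrDr.
Qed.

Lemma scalars_mx1 (B : starAlgType C) : scalars_mx B (1%:M : 'M[C]_d) = 1%:M.
Proof.
by apply/matrixP => i j; rewrite !mxE; case: eqP; rewrite ?scale1r ?scale0r.
Qed.

Lemma scalars_mxM (B : starAlgType C) (G H : 'M[C]_d) :
  scalars_mx B (G *m H) = scalars_mx B G *m scalars_mx B H.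
Proof.
apply/matrixP => i j; rewrite !mxE scaler_suml; apply: eq_bigr => k _.
by rewrite !mxE mulr_algl scalerA.
Qed.

Lemma star0 (B : starAlgType C) : star (0 : B) = 0.
Proof.
have h := starP (-1) (0 : B) 0.
by rewrite scaler0 addr0 rmorphN rmorph1 scaleN1r addNr in h.
Qed.

Lemma star1 (B : starAlgType C) : star (1 : B) = 1.
Proof. by rewrite -[LHS]mulr1 -[X in _ * X](starK 1) -starM mulr1 starK. Qed.

Lemma starD (B : starAlgType C) (a b : B) : star (a + b) = star a + star b.
Proof. by have := starP 1 a b; rewrite rmorph1 !scale1r. Qed.

Lemma starZ (B : starAlgType C) c (a : B) : star (c *: a) = c^* *: star a.
Proof. by have := starP c a 0; rewrite star0 !addr0. Qed.

Lemma unitary_mx1 (B : starAlgType C) : unitary_mx (1%:M : 'M[B]_d).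
Proof.
suff h : adj_mx (1%:M : 'M[B]_d) = 1%:M by split; rewrite h mulmx1.
apply/matrixP => i j; rewrite !mxE eq_sym.
by case: eqP; rewrite ?star1 ?star0.
Qed.

Lemma UF_relations1 (B : starAlgType C) : UF_relations F (1%:M : 'M[B]_d).
Proof.
split; first exact: unitary_mx1.
have -> : bar_mx (1%:M : 'M[B]_d) = 1%:M.
  by apply/matrixP => i j; rewrite !mxE; case: eqP; rewrite ?star1 ?star0.
rewrite mulmx1 -scalars_mxM mulmxV // scalars_mx1; exact: unitary_mx1.
Qed.

Fact pol_one_neq0 : pol_one != pol_zero.
Proof.
apply/eqP => /pol_ofP /(_ C^o _ (@UF_relations1 C^o)) /=.
by rewrite scale1r scale0r => /eqP; rewrite oner_eq0.
Qed.

HB.instance Definition _ := GRing.Zmodule_isNzRing.Build P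
  pol_mulA pol_mul1 pol_mulr1 pol_mulDl pol_mulDr pol_one_neq0.

Fact pol_scaleA (a b : C) (v : P) :
  pol_scale a (pol_scale b v) = pol_scale (a * b) v.
Proof. by pol_tac; rewrite !mulr_algl scalerA. Qed.
Fact pol_scale1 : left_id 1 pol_scale.
Proof. by pol_tac; rewrite scale1r mul1r. Qed.
Fact pol_scaleDr : right_distributive pol_scale +%R.
Proof. rewrite /GRing.add /=; pol_tac; exact: mulrDr. Qed.
Fact pol_scaleDl (v : P) : {morph pol_scale^~ v : a b / a + b}.
Proof. rewrite /GRing.add /=; pol_tac; by rewrite -mulrDl -scalerDl. Qed.

HB.instance Definition _ := GRing.Zmodule_isLmodule.Build C P
  pol_scaleA pol_scale1 pol_scaleDr pol_scaleDl.

Fact pol_scaleAl (k : C) (x y : P) : k *: (x * y) = (k *: x) * y.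
Proof. by rewrite /GRing.scale /GRing.mul /=; pol_tac; rewrite mulrA. Qed.

HB.instance Definition _ := GRing.Lmodule_isLalgebra.Build C P pol_scaleAl.

Fact pol_scaleAr (k : C) (x y : P) : k *: (x * y) = x * (k *: y).
Proof.
by rewrite /GRing.scale /GRing.mul /=; pol_tac; rewrite !mulr_algl scalerAr.
Qed.

HB.instance Definition _ := GRing.Lalgebra_isAlgebra.Build C P pol_scaleAr.

Fact pol_starK : involutive pol_star.
Proof. by pol_tac; rewrite starK. Qed.
Fact pol_starM (a b : P) : pol_star (a * b) = pol_star b * pol_star a.
Proof. by rewrite /GRing.mul /=; pol_tac; rewrite starM. Qed.
Fact pol_starP (c : C) (a b : P) :
  pol_star (c *: a + b) = c^* *: pol_star a + pol_star b.
Proof.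
by rewrite /GRing.scale /GRing.add /=; pol_tac; rewrite !mulr_algl starP.
Qed.

HB.instance Definition _ := hasStar.Build C P pol_starK pol_starM pol_starP.

Definition pol_gen : 'M[P]_d := \matrix_(j, k) pol_of (TGen j k).

Lemma pol_ofD s t : pol_of (TAdd s t) = pol_of s + pol_of t.
Proof. by rewrite /GRing.add /=; pol_tac. Qed.
Lemma pol_ofM s t : pol_of (TMul s t) = pol_of s * pol_of t.
Proof. by rewrite /GRing.mul /=; pol_tac. Qed.
Lemma pol_ofS s : pol_of (TStar s) = star (pol_of s).
Proof. by rewrite /star /=; pol_tac. Qed.
Lemma pol_ofC c : pol_of (TConst c) = c%:A.
Proof. by rewrite /GRing.scale /GRing.one /=; pol_tac; rewrite scale1r mulr1. Qed.

Lemma teval_gen t : teval pol_gen t = pol_of t.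
Proof.
elim: t => [j k|c|s ihs t iht|s ihs t iht|s ihs] /=.
- by rewrite mxE.
- by rewrite pol_ofC.
- by rewrite ihs iht pol_ofD.
- by rewrite ihs iht pol_ofM.
- by rewrite ihs pol_ofS.
Qed.

Section Lift.
Variables (B : starAlgType C) (v : 'M[B]_d) (hv : UF_relations F v).

Definition pol_lift_fun (a : P) : B := teval v (repr a).

Fact pol_lift_linear : linear pol_lift_fun.
Proof.
move=> c a b; rewrite /pol_lift_fun {1}/GRing.scale {1}/GRing.add /=.
by rewrite /pol_add /pol_scale !teval_repr //= !teval_repr //= mulr_algl.
Qed.

Fact pol_lift_multiplicative : monoid_morphism pol_lift_fun.
Proof.
split; rewrite /pol_lift_fun; first by rewrite teval_repr //= scale1r.
by move=> a b; rewrite {1}/GRing.mul /= teval_repr.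
Qed.

HB.instance Definition _ := GRing.isLinear.Build C P B _ pol_lift_fun
  pol_lift_linear.
HB.instance Definition _ := GRing.isMonoidMorphism.Build P B pol_lift_fun
  pol_lift_multiplicative.

Fact pol_lift_star (a : P) : pol_lift_fun (star a) = star (pol_lift_fun a).
Proof. by rewrite /pol_lift_fun {1}/star /= teval_repr. Qed.

Definition pol_lift : starMorphism P B := @StarMorphism C P B
  pol_lift_fun pol_lift_star.

Lemma pol_lift_of t : pol_lift (pol_of t) = teval v t.
Proof. exact: teval_repr. Qed.

Lemma pol_liftE j k : pol_lift (pol_gen j k) = v j k.
Proof. by rewrite mxE pol_lift_of. Qed.
End Lift.

Lemma pol_morphism_eq (B : starAlgType C) (f g : starMorphism P B) :
  (forall j k, f (pol_gen j k) = g (pol_gen j k)) -> f =1 g.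
Proof.
move=> h a; rewrite -[a]reprK -/(pol_of _).
elim: (repr a) => [j k|c|s ihs t iht|s ihs t iht|s ihs].
- by have := h j k; rewrite mxE.
- by rewrite pol_ofC !linearZ !rmorph1.
- by rewrite pol_ofD !linearD /= ihs iht.
- by rewrite pol_ofM !rmorphM /= ihs iht.
- by rewrite pol_ofS !star_morphismP ihs.
Qed.

Lemma pol_lift_inj (a b : P) :
  (forall (B : starAlgType C) (v : 'M[B]_d) (hv : UF_relations F v),
     pol_lift hv a = pol_lift hv b) -> a = b.
Proof. by move=> h; apply: pol_ext => B v hv; exact: (h B v hv). Qed.

Lemma pol_gen_relations : UF_relations F pol_gen.
Proof.
have liftM (B : starAlgType C) (v : 'M[B]_d) (hv : UF_relations F v)
    (X Y : 'M[P]_d) : map_mx (pol_lift hv) (X *m Y) =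
      map_mx (pol_lift hv) X *m map_mx (pol_lift hv) Y.
  exact: map_mxM.
have lift1 (B : starAlgType C) (v : 'M[B]_d) (hv : UF_relations F v) :
    map_mx (pol_lift hv) 1%:M = 1%:M.
  exact: map_mx1.
have liftbar (B : starAlgType C) (v : 'M[B]_d) (hv : UF_relations F v)
    (X : 'M[P]_d) : map_mx (pol_lift hv) (bar_mx X) =
      bar_mx (map_mx (pol_lift hv) X).
  by apply/matrixP => i j; rewrite !mxE star_morphismP.
have liftgen (B : starAlgType C) (v : 'M[B]_d) (hv : UF_relations F v) :
    map_mx (pol_lift hv) pol_gen = v.
  by apply/matrixP => i j; rewrite mxE pol_liftE.
have liftsc (B : starAlgType C) (v : 'M[B]_d) (hv : UF_relations F v)
    (G : 'M[C]_d) : map_mx (pol_lift hv) (scalars_mx P G) = scalars_mx B G.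
  by apply/matrixP => i j; rewrite !mxE linearZ rmorph1.
have ext (X Y : 'M[P]_d) : (forall (B : starAlgType C) (v : 'M[B]_d)
    (hv : UF_relations F v), map_mx (pol_lift hv) X = map_mx (pol_lift hv) Y) ->
    X = Y.
  move=> h; apply/matrixP => i j; apply: pol_lift_inj => B v hv.
  by have /matrixP/(_ i j) := h B v hv; rewrite !mxE.
have unit_of (X : 'M[P]_d) : (forall (B : starAlgType C) (v : 'M[B]_d)
    (hv : UF_relations F v), unitary_mx (map_mx (pol_lift hv) X)) ->
    unitary_mx X.
  have liftadj (B : starAlgType C) (v : 'M[B]_d) (hv : UF_relations F v) :
      map_mx (pol_lift hv) (adj_mx X) = adj_mx (map_mx (pol_lift hv) X).
    by apply/matrixP => i j; rewrite !mxE star_morphismP.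
  by move=> h; split; apply: ext => B v hv; rewrite liftM lift1 liftadj;
    case: (h B v hv).
split; apply: unit_of => B v hv; rewrite ?liftM ?liftsc ?liftbar liftgen;
  by case: hv.
Qed.

Definition counit : character P := pol_lift (@UF_relations1 C^o).

Lemma counitE j k : counit (pol_gen j k) = (j == k)%:R.
Proof. by rewrite pol_liftE mxE. Qed.

End Pol.

(* The roots of the characteristic polynomial, with multiplicity. *)
Definition eigenvalues (C : numClosedFieldType) (d : nat) (M : 'M[C]_d) :
  seq C := sval (closed_field_poly_normal (char_poly M)).

Definition non_generic (C : numClosedFieldType) (d : nat) (F : 'M[C]_d) :=
  ~~ uniq (eigenvalues ((map_mx Num.conj F)^T *m F)).

(* Inner products are linear in the second argument. *)
HB.mixin Record hasInner (R : realType) H of GRing.Lmodule R[i] H := {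
  inner : H -> H -> R[i];
  inner_linear : forall x (c : R[i]) y z,
    inner x (c *: y + z) = c * inner x y + inner x z;
  innerC : forall x y, inner y x = (inner x y)^*;
  inner_ge0 : forall x, 0 <= inner x x;
  inner_eq0 : forall x, inner x x = 0 -> x = 0
}.

#[short(type="preHilbertType")]
HB.structure Definition PreHilbert (R : realType) :=
  {H of GRing.Lmodule R[i] H & hasInner R H}.

Definition hnorm (R : realType) (H : preHilbertType R) (x : H) : R :=
  Num.sqrt (complex.Re (inner x x)).

Definition hcauchy (R : realType) (H : preHilbertType R) (u : nat -> H) :=
  forall e : R, 0 < e -> exists N : nat,
    forall m n, (N <= m)%N -> (N <= n)%N -> hnorm (u m - u n) < e.

Definition hcvg (R : realType) (H : preHilbertType R) (u : nat -> H) (l : H) :=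
  forall e : R, 0 < e -> exists N : nat,
    forall n, (N <= n)%N -> hnorm (u n - l) < e.

HB.mixin Record PreHilbert_isComplete (R : realType) H of PreHilbert R H := {
  hcauchy_cvg : forall u : nat -> H, hcauchy u -> exists l, hcvg u l
}.

#[short(type="hilbertType")]
HB.structure Definition Hilbert (R : realType) :=
  {H of PreHilbert R H & PreHilbert_isComplete R H}.

Section InnerTheory.
Variables (R : realType) (H : preHilbertType R).
Implicit Types (x y z : H) (c : R[i]).

Lemma innerDr x y z : inner x (y + z) = inner x y + inner x z.
Proof. by have := inner_linear x 1 y z; rewrite scale1r mul1r. Qed.

Lemma inner0r x : inner x 0 = 0.
Proof. by apply: (addrI (inner x 0)); rewrite -innerDr !addr0. Qed.

Lemma innerZr x c y : inner x (c *: y) = c * inner x y.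
Proof. by have := inner_linear x c y 0; rewrite inner0r !addr0. Qed.

Lemma innerNr x y : inner x (- y) = - inner x y.
Proof. by rewrite -scaleN1r innerZr mulN1r. Qed.

Lemma innerBr x y z : inner x (y - z) = inner x y - inner x z.
Proof. by rewrite innerDr innerNr. Qed.

Lemma innerDl x y z : inner (x + y) z = inner x z + inner y z.
Proof. by rewrite innerC innerDr rmorphD /= -!innerC. Qed.

Lemma innerZl c x y : inner (c *: x) y = c^* * inner x y.
Proof. by rewrite innerC innerZr rmorphM /= -innerC. Qed.

Lemma innerNl x y : inner (- x) y = - inner x y.
Proof. by rewrite innerC innerNr rmorphN /= -innerC. Qed.

Lemma innerBl x y z : inner (x - y) z = inner x z - inner y z.
Proof. by rewrite innerDl innerNl. Qed.

Lemma inner0l x : inner 0 x = 0.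
Proof. by rewrite innerC inner0r rmorph0. Qed.

Definition hsq x : R := complex.Re (inner x x).

Lemma hsqE x : inner x x = (hsq x)%:C%C.
Proof.
rewrite /hsq; have := inner_ge0 x; case: (inner x x) => a b.
by rewrite lecE /= => /andP[/eqP -> _].
Qed.

Lemma hsq_ge0 x : 0 <= hsq x.
Proof. by have := inner_ge0 x; rewrite hsqE lecR. Qed.

Lemma hnorm_lt x (e : R) : 0 < e -> (hnorm x < e) = (hsq x < e ^+ 2).
Proof.
move=> e0; rewrite -(@ltr_pXn2r _ 2) ?nnegrE ?sqrtr_ge0 ?(ltW e0) //.
by rewrite sqr_sqrtr ?hsq_ge0.
Qed.

Lemma hsq_parallelogram x y :
  hsq (x + y) + hsq (x - y) = 2 * hsq x + 2 * hsq y.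
Proof.
apply: (fmorph_inj (real_complex R)).
rewrite !rmorphD !rmorphM /= -!hsqE !(innerDl, innerDr, innerNl, innerNr).
rewrite [(2)%:C%C]rmorph_nat; ring.
Qed.

Lemma hsq_min_inner w z (D : R) : (forall c, D <= hsq (w - c *: z)) ->
  `|inner z w| ^+ 2 <= (hsq z * (hsq w - D))%:C%C.
Proof.
move=> hD; have [z0|z0] := eqVneq (inner z z) 0.
  rewrite (inner_eq0 _ z0) inner0l normr0 expr0n /= /hsq inner0l /= mul0r.
  by [].
have {hD} := hD (inner z w / inner z z).
rewrite -lecR -hsqE innerBl !innerBr !innerZl !innerZr.
have -> : (inner z w / inner z z)^* = inner w z / inner z z.
  by rewrite rmorphM fmorphV /= -!innerC.
move=> hD; rewrite normCK -innerC rmorphM rmorphB /= -!hsqE.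
have zp : 0 < inner z z by rewrite lt_def z0 inner_ge0.
rewrite -ler_pdivrMl // lerBrDl -lerBrDr.
apply: le_trans hD _; rewrite le_eqVlt; apply/orP; left; apply/eqP.
by field.
Qed.

Lemma cauchy_schwarz x y : `|inner x y| ^+ 2 <= (hsq x * hsq y)%:C%C.
Proof.
by have := @hsq_min_inner y x 0 (fun c => hsq_ge0 _); rewrite subr0.
Qed.

End InnerTheory.

Section HilbertTheory.
Variable R : realType.

Lemma small_norm0 (c : R[i]) (M : R) : 0 <= M ->
  (forall e : R, 0 < e -> `|c| ^+ 2 <= (M * e)%:C%C) -> c = 0.
Proof.
move=> M0 h; apply/eqP; rewrite -normr_eq0; apply/eqP.
have [//|c0] := eqVneq `|c| 0.
have cE : `|c| ^+ 2 = (complex.Re `|c| ^+ 2)%:C%C.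
  by rewrite [in LHS](_ : `|c| = (complex.Re `|c|)%:C%C) -?rmorphXn //;
    case: c {h c0}.
have cp : 0 < complex.Re `|c| ^+ 2.
  by rewrite -ltcR -cE exprn_gt0 // lt_def c0 normr_ge0.
set a := complex.Re _ ^+ 2 in cE cp.
have M1 : 0 < M + 1 by lra.
have := h (a / (M + 1)) (divr_gt0 cp M1); rewrite cE lecR mulrA.
rewrite ler_pdivlMr // => h1; exfalso; nra.
Qed.

Lemma norm_add_sq (a b : R[i]) :
  `|a + b| ^+ 2 <= 2 * `|a| ^+ 2 + 2 * `|b| ^+ 2.
Proof.
rewrite -subr_ge0; have -> : 2 * `|a| ^+ 2 + 2 * `|b| ^+ 2 - `|a + b| ^+ 2
  = `|a - b| ^+ 2 by rewrite !normCK rmorphB rmorphD /=; ring.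
by rewrite exprn_ge0.
Qed.

Variable H : hilbertType R.
Implicit Types (x y z : H).

Lemma hcvg_hsq (v : nat -> H) l : hcvg v l ->
  forall e : R, 0 < e -> exists N, forall n, (N <= n)%N -> hsq (v n - l) < e.
Proof.
move=> vl e e0; have [|N hN] := vl (Num.sqrt e); first by rewrite sqrtr_gt0.
exists N => n /hN; rewrite hnorm_lt ?sqrtr_gt0 // sqr_sqrtr //; exact: ltW.
Qed.

Lemma inner_cvg0 (v : nat -> H) (l w : H) :
  hcvg v l -> (forall n, inner w (v n) = 0) -> inner w l = 0.
Proof.
move=> vl v0; apply: (@small_norm0 _ (hsq w)) => [|e e0]; first exact: hsq_ge0.
have [N /(_ N (leqnn N)) hN] := hcvg_hsq vl e0.
rewrite -normrN -innerNr -[inner w (- l)]add0r -(v0 N) -innerDr.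
apply: le_trans (cauchy_schwarz _ _) _; rewrite lecR.
by apply: ler_wpM2l; [exact: hsq_ge0 | exact: ltW].
Qed.

End HilbertTheory.

Record closedSubspace (R : realType) (H : hilbertType R) := ClosedSubspace {
  csub_pred :> H -> bool;
  csub_submod : subsemimod_closed csub_pred;
  csub_closed : forall (v : nat -> H) l,
    (forall n, v n \in csub_pred) -> hcvg v l -> l \in csub_pred
}.

HB.instance Definition _ (R : realType) (H : hilbertType R)
  (V : closedSubspace H) :=
  GRing.isSubmodClosed.Build R[i] H V (csub_submod V).

Section Subspace.
Variables (R : realType) (H : hilbertType R) (V : closedSubspace H).

Record subspace := Subspace { subspace_val : H; _ : subspace_val \in csub_pred V }.

HB.instance Definition _ := [isSub for subspace_val].
HB.instance Definition _ := [Choice of subspace by <:].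
HB.instance Definition _ := [SubChoice_isSubLmodule of subspace by <:].

Definition subspace_inner (x y : subspace) : R[i] := inner (val x) (val y).

Fact subspace_inner_linear x (c : R[i]) y z :
  subspace_inner x (c *: y + z) = c * subspace_inner x y + subspace_inner x z.
Proof. by rewrite /subspace_inner linearP inner_linear. Qed.

Fact subspace_innerC x y : subspace_inner y x = (subspace_inner x y)^*.
Proof. exact: innerC. Qed.

Fact subspace_inner_ge0 x : 0 <= subspace_inner x x.
Proof. exact: inner_ge0. Qed.

Fact subspace_inner_eq0 x : subspace_inner x x = 0 -> x = 0.
Proof. by move=> h; apply: val_inj; rewrite linear0; exact: inner_eq0. Qed.

HB.instance Definition _ := hasInner.Build R subspace subspace_inner_linear
  subspace_innerC subspace_inner_ge0 subspace_inner_eq0.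

Lemma hnorm_subspace (x : subspace) : hnorm x = hnorm (val x).
Proof. by []. Qed.

Fact subspace_complete (v : nat -> subspace) :
  hcauchy v -> exists l, hcvg v l.
Proof.
move=> vC; have [|l hl] := @hcauchy_cvg R H (fun n => val (v n)).
  move=> e /vC[N hN]; exists N => m n Nm Nn.
  by have := hN m n Nm Nn; rewrite hnorm_subspace linearB.
have lV : l \in csub_pred V by apply: (csub_closed _ hl) => n; exact: valP.
exists (Subspace lV) => e /hl[N hN]; exists N => n /hN.
by rewrite hnorm_subspace linearB.
Qed.

HB.instance Definition _ := PreHilbert_isComplete.Build R subspace
  subspace_complete.

Lemma exists_proj (x : H) :
  exists y : subspace, forall z : subspace, inner (val z) (x - val y) = 0.
Proof.
pose E := [set r | exists z : subspace, r = hsq (x - val z)]%classic.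
have Elb : has_lbound E by exists 0 => _ [z ->]; exact: hsq_ge0.
have Ei : has_inf E by split => //; exists (hsq (x - val (0 : subspace))), 0.
pose D := inf E.
have hD (z : subspace) : D <= hsq (x - val z) by apply: ge_inf => //; exists z.
have /choice[v hv] (n : nat) : exists z : subspace,
    hsq (x - val z) < D + n.+1%:R^-1.
  have [|_ [z ->] hz] := inf_adherent (eps := n.+1%:R^-1) _ Ei.
    by rewrite invr_gt0 ltr0n.
  by exists z.
have invN (e : R) : 0 < e ->
    exists N, forall n, (N <= n)%N -> n.+1%:R^-1 < e.
  move=> e0; exists (Num.bound e^-1) => n hn.
  rewrite -[e]invrK ltf_pV2 ?posrE ?invr_gt0 ?ltr0n //.
  apply: lt_le_trans (archi_boundP _) _; first by rewrite invr_ge0 ltW.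
  by rewrite ler_nat (leq_trans hn).
have vC : hcauchy v.
  move=> e e0; have e2 : 0 < e ^+ 2 / 4 by rewrite divr_gt0 ?exprn_gt0 // ltr0n.
  have [N hN] := invN _ e2; exists N => m n Nm Nn.
  rewrite hnorm_subspace hnorm_lt // linearB.
  rewrite -[ltLHS]/(hsq (val (v m) - val (v n))).
  have := hsq_parallelogram (x - val (v n)) (x - val (v m)).
  have -> : x - val (v n) - (x - val (v m)) = val (v m) - val (v n).
    by rewrite opprB addrC addrA subrK.
  pose mid : subspace := 2^-1 *: (v n + v m).
  have -> : x - val (v n) + (x - val (v m)) = 2 *: (x - val mid).
    have -> : val mid = 2^-1 *: (val (v n) + val (v m)).
      by rewrite /mid linearZ linearD.
    rewrite scalerBr scalerA divff ?pnatr_eq0 //.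
    by rewrite scale1r scaler_nat mulr2n opprD addrACA.
  have -> : hsq (2 *: (x - val mid)) = 4 * hsq (x - val mid).
    apply: (fmorph_inj (real_complex R)); rewrite rmorphM /= -!hsqE.
    rewrite innerZl innerZr conjC_nat rmorph_nat; ring.
  have := hD mid; have := hv n; have := hv m; have := hN _ Nm; have := hN _ Nn.
  move: (n.+1%:R^-1) (m.+1%:R^-1) (hsq (val (v m) - val (v n))) (hsq _)
    (hsq _) (hsq _) (e ^+ 2) (D) => a b p q r s f D' ? ? ? ? ? ?; lra.
have [y hy] := subspace_complete vC; exists y => z.
apply: (@small_norm0 _ _ (2 * hsq (val z) + 2 * hsq (val z))) => [|e e0].
  by have := hsq_ge0 (val z); lra.
have [N hN] := invN _ e0; have [M hM] := hcvg_hsq hy e0.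
pose n := maxn N M.
have -> : x - val y = (x - val (v n)) + val (v n - y).
  by rewrite linearB /= addrA subrK.
rewrite innerDr; apply: le_trans (norm_add_sq _ _) _.
have -> : (2 * hsq (val z) + 2 * hsq (val z)) * e =
    2 * (hsq (val z) * e) + 2 * (hsq (val z) * e) by ring.
rewrite -[leRHS]/(real_complex R _) rmorphD rmorphM /= rmorph_nat.
apply: lerD; apply: ler_wpM2l => //.
  apply: le_trans (hsq_min_inner (D := D) _) _ => [c|].
    have -> : x - val (v n) - c *: val z = x - val (v n + c *: z).
      by rewrite -addrA -opprD.
    exact: hD.
  rewrite lecR; apply: ler_wpM2l; first exact: hsq_ge0.
  rewrite lerBlDl; apply: le_trans (ltW (hv n)) _.
  by rewrite lerD2l; exact/ltW/hN/leq_maxl.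
apply: le_trans (cauchy_schwarz _ _) _; rewrite lecR.
apply: ler_wpM2l; first exact: hsq_ge0.
exact/ltW/(hM n)/leq_maxr.
Qed.

Definition proj (x : H) : subspace := sval (cid (exists_proj x)).

Lemma projP (x : H) (z : subspace) : inner (val z) (x - val (proj x)) = 0.
Proof. exact: (svalP (cid (exists_proj x))). Qed.

Definition orth_pred (x : H) : bool :=
  `[< forall z : subspace, inner (val z) x = 0 >].

Fact orth_submod : subsemimod_closed orth_pred.
Proof.
split; first split; first by apply/asboolP => z; exact: inner0r.
  move=> x y /asboolP hx /asboolP hy; apply/asboolP => z.
  by rewrite innerDr hx hy addr0.
by move=> c x /asboolP hx; apply/asboolP => z; rewrite innerZr hx mulr0.
Qed.

Fact orth_closed (v : nat -> H) l :
  (forall n, v n \in orth_pred) -> hcvg v l -> l \in orth_pred.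
Proof.
move=> hv vl; apply/asboolP => z; apply: (inner_cvg0 vl) => n.
by have /asboolP := hv n.
Qed.

Definition orth : closedSubspace H := ClosedSubspace orth_submod orth_closed.

Lemma proj_orth (x : H) : x - val (proj x) \in csub_pred orth.
Proof. by apply/asboolP => z; exact: projP. Qed.

End Subspace.

Record representation (R : realType) (A : starAlgType R[i])
    (H : hilbertType R) := Representation {
  rep_fun :> A -> {linear H -> H};
  rep_bounded : forall a, exists M : R, forall x, hnorm (rep_fun a x) <= M * hnorm x;
  rep_linear : forall (c : R[i]) a b x,
    rep_fun (c *: a + b) x = c *: rep_fun a x + rep_fun b x;
  rep1 : forall x, rep_fun 1 x = x;
  repM : forall a b x, rep_fun (a * b) x = rep_fun a (rep_fun b x);
  rep_star : forall a x y, inner (rep_fun (star a) x) y = inner x (rep_fun a y)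
}.

Section Representations.
Variables (R : realType) (A : starAlgType R[i]) (eps : character A).

Section EpsRep.
Variable H : hilbertType R.

Definition eps_op (a : A) : H -> H := fun x => (eps a : R[i]) *: x.

Fact eps_op_linear a : linear (eps_op a).
Proof.
by move=> c x y; rewrite /eps_op scalerDr !scalerA [_ * c]mulrC.
Qed.

HB.instance Definition _ a := GRing.isLinear.Build R[i] H H _ (eps_op a)
  (eps_op_linear a).

Fact eps_op_bounded a :
  exists M : R, forall x, hnorm (eps_op a x) <= M * hnorm x.
Proof.
pose c : R[i] := eps a.
have cE : c^* * c = (complex.Re (c^* * c))%:C%C.
  have : 0 <= c^* * c by rewrite mulrC mul_conjC_ge0.
  by case: (c^* * c) => s t; rewrite lecE /= => /andP[/eqP -> _].
exists (Num.sqrt (complex.Re (c^* * c))) => x.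
rewrite /hnorm -sqrtrM; last first.
  by rewrite -lecR -cE mulrC mul_conjC_ge0.
rewrite /eps_op innerZl innerZr mulrA -/c cE hsqE.
by rewrite -rmorphM.
Qed.

Fact eps_op_rep (c : R[i]) a b (x : H) :
  eps_op (c *: a + b) x = c *: eps_op a x + eps_op b x.
Proof. by rewrite /eps_op linearP scalerDl scalerA. Qed.

Fact eps_op1 (x : H) : eps_op 1 x = x.
Proof. by rewrite /eps_op rmorph1 scale1r. Qed.

Fact eps_opM a b (x : H) : eps_op (a * b) x = eps_op a (eps_op b x).
Proof. by rewrite /eps_op rmorphM scalerA. Qed.

Fact eps_op_star a (x y : H) :
  inner (eps_op (star a) x) y = inner x (eps_op a y).
Proof.
by rewrite /eps_op star_morphismP innerZl innerZr conjCK.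
Qed.

Definition eps_rep : representation A H := @Representation R A H
  (fun a => eps_op a) eps_op_bounded eps_op_rep eps_op1 eps_opM eps_op_star.
End EpsRep.

Section Restriction.
Variables (H : hilbertType R) (rho : representation A H).
Variable V : closedSubspace H.
Hypothesis Vinv :
  forall a x, x \in csub_pred V -> rho a x \in csub_pred V.

Definition restrict_op (a : A) (x : subspace V) : subspace V :=
  Subspace (Vinv a (valP x)).

Fact restrict_op_linear a : linear (restrict_op a).
Proof. by move=> c x y; apply: val_inj; exact: (linearP (rho a)). Qed.

HB.instance Definition _ a := GRing.isLinear.Build R[i] (subspace V)
  (subspace V) _ (restrict_op a) (restrict_op_linear a).

Fact restrict_bounded a :
  exists M : R, forall x, hnorm (restrict_op a x) <= M * hnorm x.
Proof. by have [M hM] := rep_bounded rho a; exists M => x; apply: hM. Qed.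

Fact restrict_rep (c : R[i]) a b x :
  restrict_op (c *: a + b) x = c *: restrict_op a x + restrict_op b x.
Proof. by apply: val_inj; exact: rep_linear. Qed.

Fact restrict1 x : restrict_op 1 x = x.
Proof. by apply: val_inj; rewrite /= rep1. Qed.

Fact restrictM a b x :
  restrict_op (a * b) x = restrict_op a (restrict_op b x).
Proof. by apply: val_inj; rewrite /= repM. Qed.

Fact restrict_star a x y :
  inner (restrict_op (star a) x) y = inner x (restrict_op a y).
Proof. exact: rep_star. Qed.

Definition restrict : representation A (subspace V) :=
  @Representation R A (subspace V) (fun a => restrict_op a)
    restrict_bounded restrict_rep restrict1 restrictM restrict_star.
End Restriction.

Section GaussianPart.
Variables (H : hilbertType R) (rho : representation A H).

Definition gauss_pred (x : H) : bool :=
  `[< forall a, rho a x = (eps a : R[i]) *: x >].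

Fact gauss_submod : subsemimod_closed gauss_pred.
Proof.
split; first split; first by apply/asboolP => a; rewrite linear0 scaler0.
  move=> x y /asboolP hx /asboolP hy; apply/asboolP => a.
  by rewrite linearD hx hy scalerDr.
move=> c x /asboolP hx; apply/asboolP => a.
by rewrite linearZ /= hx !scalerA mulrC.
Qed.

Fact gauss_closed (v : nat -> H) l :
  (forall n, v n \in gauss_pred) -> hcvg v l -> l \in gauss_pred.
Proof.
move=> hv vl; apply/asboolP => a; apply/eqP; rewrite -subr_eq0; apply/eqP.
have E w x : inner w (rho a x - (eps a : R[i]) *: x) =
    inner (rho (star a) w - (eps a : R[i])^* *: w) x.
  by rewrite innerBr innerBl rep_star innerZr innerZl conjCK.
apply: inner_eq0; set w := (X in inner X _).
rewrite E; apply: (inner_cvg0 vl) => n; rewrite -E.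
by have /asboolP -> := hv n; rewrite subrr inner0r.
Qed.

Definition gauss_part : closedSubspace H :=
  ClosedSubspace gauss_submod gauss_closed.
Definition nongauss_part : closedSubspace H := orth gauss_part.

Fact gauss_inv a x :
  x \in csub_pred gauss_part -> rho a x \in csub_pred gauss_part.
Proof.
move=> xG; have /asboolP/(_ a) -> := xG.
exact: (csub_submod gauss_part).2.
Qed.

Fact nongauss_inv a x :
  x \in csub_pred nongauss_part -> rho a x \in csub_pred nongauss_part.
Proof.
move=> /asboolP xN; apply/asboolP => z.
by rewrite -rep_star; exact: (xN (Subspace (gauss_inv (star a) (valP z)))).
Qed.

Definition rep_G := restrict gauss_inv.
Definition rep_N := restrict nongauss_inv.

Variable eta : A -> H.

Definition cocycle_G (a : A) : subspace gauss_part := proj gauss_part (eta a).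
Definition cocycle_N (a : A) : subspace nongauss_part :=
  Subspace (proj_orth gauss_part (eta a)).
End GaussianPart.

Definition is_cocycle (H : hilbertType R) (rho : representation A H)
    (eta : A -> H) : Prop :=
  linear eta /\
  forall a b, eta (a * b) = rho a (eta b) + (eps b : R[i]) *: eta a.

Definition schurmann_triple (H : hilbertType R) (rho : representation A H)
    (eta : A -> H) (psi : A -> R[i]) : Prop :=
  [/\ is_cocycle rho eta, scalar psi
    & forall a b, psi (a * b) =
        psi a * eps b + eps a * psi b + inner (eta (star a)) (eta b)].

Definition generating_functional (psi : A -> R[i]) : Prop :=
  [/\ scalar psi, psi 1 = 0, forall a, psi (star a) = (psi a)^*
    & forall a, eps a = 0 -> 0 <= psi (star a * a)].

Definition dense_image (H : hilbertType R) (eta : A -> H) : Prop :=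
  forall (x : H) (e : R), 0 < e -> exists a, hnorm (eta a - x) < e.

Definition associated_triple (H : hilbertType R) (rho : representation A H)
    (eta : A -> H) (psi : A -> R[i]) : Prop :=
  schurmann_triple rho eta psi /\ dense_image eta.

(* The associated triple exists and is unique up to unitary equivalence, so
   quantifying over all associated triples is quantifying over "the" one. *)
Definition admits_LK (psi : A -> R[i]) : Prop :=
  forall (H : hilbertType R) (rho : representation A H) (eta : A -> H),
    associated_triple rho eta psi ->
    exists psi_G psi_N : A -> R[i],
      [/\ generating_functional psi_G, generating_functional psi_N,
          schurmann_triple (rep_G rho) (cocycle_G rho eta) psi_G
        & schurmann_triple (rep_N rho) (cocycle_N rho eta) psi_N].

Definition property_LK : Prop :=
  forall psi : A -> R[i], generating_functional psi -> admits_LK psi.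

Definition property_GC : Prop :=
  forall (H : hilbertType R) (eta : A -> H),
    is_cocycle (eps_rep H) eta ->
    exists psi, schurmann_triple (eps_rep H) eta psi.

Definition property_NC : Prop :=
  forall (H : hilbertType R) (rho : representation A H) (eta : A -> H),
    (forall x : H, (forall a, rho a x = (eps a : R[i]) *: x) -> x = 0) ->
    is_cocycle rho eta ->
    exists psi, schurmann_triple rho eta psi.

End Representations.

(* Main.v *)
From HB Require Import structures.
Require Import Defs.
From mathcomp Require Import all_boot all_order all_algebra.
From mathcomp Require Import boolp classical_sets reals complex.
From mathcomp Require Import topology normedtype sequences.
From mathcomp Require Import spectral sesquilinear ring lra.

(* Put Q = F^* F.  A Gaussian cocycle on Pol(U_F^+) amounts to a vector-valued
   matrix X = (eta(u_jk)) whose transpose commutes with Q, and so does a cocycle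
   for the representation u |-> -I.  Evaluating a completing functional on
   u^* u = I and on (bar u) Q^-1 u^t = Q^-1 shows that a scalar matrix X = N^t
   can only be completed if N is normal.  A repeated eigenvalue of the Hermitian
   matrix Q gives a non-normal N commuting with Q, which kills (GC); applied to
   N^* and u |-> -I, the same argument kills (NC).  In the direct sum of these
   two cocycles the defects N N^* - N^* N and N^* N - N N^* cancel, so that the
   sum is part of a Schürmann triple; its Gaussian part is not, which kills
   (LK). *)

Set Implicit Arguments.
Unset Strict Implicit.
Unset Printing Implicit Defensive.

Import Order.TTheory GRing.Theory Num.Theory numFieldNormedType.Exports.
Local Open Scope ring_scope.
Local Open Scope sesquilinear_scope.

(** * Adjoints, repeated eigenvalues and commutants of complex matrices *)

Section Matrices.
Variable C : numClosedFieldType.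

Lemma trmxC_mul m n p (A : 'M[C]_(m, n)) (B : 'M[C]_(n, p)) :
  (A *m B)^t* = B^t* *m A^t*.
Proof. by rewrite trmx_mul map_mxM. Qed.

Lemma trmxC1 n : (1%:M : 'M[C]_n)^t* = 1%:M.
Proof. by rewrite trmx1 map_mx1. Qed.

Lemma trmxCN m n (A : 'M[C]_(m, n)) : (- A)^t* = - A^t*.
Proof. by rewrite linearN /= map_mxN. Qed.

Lemma trmxCD m n (A B : 'M[C]_(m, n)) : (A + B)^t* = A^t* + B^t*.
Proof. by rewrite linearD /= map_mxD. Qed.

Lemma trmxCZ m n k (A : 'M[C]_(m, n)) : (k *: A)^t* = k^* *: A^t*.
Proof. by rewrite linearZ /= map_mxZ. Qed.

Lemma trmxCB m n (A B : 'M[C]_(m, n)) : (A - B)^t* = A^t* - B^t*.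
Proof. by rewrite !raddfB. Qed.

Lemma trmxC_inv n (A : 'M[C]_n) : (invmx A)^t* = invmx (A^t*).
Proof. by rewrite trmx_inv map_invmx. Qed.

Lemma hermitian_commutant n (Q N : 'M[C]_n) : Q^t* = Q ->
  Q *m N = N *m Q -> Q *m N^t* = N^t* *m Q.
Proof. by move=> Qh QN; rewrite -[in RHS]Qh -trmxC_mul QN trmxC_mul Qh. Qed.

Lemma hermitian_gram m n (F : 'M[C]_(m, n)) : (F^t* *m F)^t* = F^t* *m F.
Proof. by rewrite trmxC_mul trmxCK. Qed.

Lemma mxtrace_adj_eq0 n (T : 'M[C]_n) : \tr (T *m T^t*) = 0 -> T = 0.
Proof.
have hij i j : 0 <= `|T i j| ^+ 2 by rewrite exprn_ge0.
have -> : \tr (T *m T^t*) = \sum_i \sum_j `|T i j| ^+ 2.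
  apply: eq_bigr => i _; rewrite mxE; apply: eq_bigr => j _.
  by rewrite !mxE normCK.
move=> /eqP; rewrite psumr_eq0 => [/allP h|i _]; last by apply: sumr_ge0.
apply/matrixP => i j; rewrite mxE; apply/eqP.
have /= := h i (mem_index_enum _); rewrite psumr_eq0 // => /allP/(_ j).
by rewrite mem_index_enum expf_eq0 normr_eq0 => /(_ isT).
Qed.

Lemma char_poly_conj n (P D : 'M[C]_n) : P \in unitmx ->
  char_poly (invmx P *m D *m P) = char_poly D.
Proof.
move=> Pu; pose f := map_mx (@polyC C).
have fM X Y : f n n (X *m Y) = f n n X *m f n n Y by exact: map_mxM.
have fP : f n n (invmx P) *m f n n P = 1%:M by rewrite -fM mulVmx // /f map_mx1.
rewrite /char_poly /char_poly_mx.
have -> : 'X%:M - f n n (invmx P *m D *m P) =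
    f n n (invmx P) *m ('X%:M - f n n D) *m f n n P.
  by rewrite !fM mulmxBr mulmxBl scalar_mxC -[_%:M *m _ *m _]mulmxA fP mulmx1.
by rewrite !det_mulmx mulrAC -det_mulmx fP det1 mul1r.
Qed.

(** By contraposition: pairwise distinct diagonal entries are [n] distinct roots of the
    characteristic polynomial, and a list of only [n] roots that contains them all has no
    repetition. *)
Lemma non_uniq_eigenvalues_diag n (Q P : 'M[C]_n) (D : 'rV[C]_n) :
    P \in unitmx -> Q = invmx P *m diag_mx D *m P ->
  ~~ uniq (eigenvalues Q) -> exists i j, i != j /\ D 0 i = D 0 j.
Proof.
move=> Pu QE; apply: contraNP => Dinj.
have D_inj : injective (D 0).
  by move=> i j Dij; apply/eqP/negPn/negP => ij; apply: Dinj; exists i, j.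
have chE : char_poly Q = \prod_(i < n) ('X - (D 0 i)%:P).
  rewrite QE char_poly_conj // char_poly_trig ?diag_mx_is_trig //.
  by apply: eq_bigr => i _; rewrite mxE eqxx.
rewrite /eigenvalues; case: closed_field_poly_normal => s /=.
rewrite (monicP (char_poly_monic Q)) scale1r => sE.
apply: (@leq_size_uniq _ [seq D 0 i | i <- enum 'I_n]).
- by rewrite map_inj_uniq ?enum_uniq.
- move=> _ /mapP[i _ ->]; rewrite -root_prod_XsubC -sE chE.
  by rewrite (bigD1 i) //= rootM root_XsubC eqxx.
rewrite size_map size_enum_ord.
have := size_char_poly Q; rewrite sE size_prod_XsubC => -[->].
by [].
Qed.

(** In an orthonormal eigenbasis of [Q], take for [N] the matrix unit [E_ij], where [i] and [j] are
    distinct indices with the same eigenvalue. Equality of the eigenvalues gives the commutation,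
    while [N N^*] and [N^* N] are [E_ii] and [E_jj]. *)
Lemma repeated_eigenvalue_commutant n (Q : 'M[C]_n) : Q^t* = Q ->
    ~~ uniq (eigenvalues Q) ->
  exists N : 'M[C]_n, Q *m N = N *m Q /\ N *m N^t* <> N^t* *m N.
Proof.
move=> Qh hQ; have Qn : Q \is normalmx by apply/normalmxP; rewrite Qh.
have Pu := spectral_unitarymx Q; have QE := orthomx_spectralP Qn.
have Pi := unitarymx_unit Pu.
have [i [j [ij Dij]]] := non_uniq_eigenvalues_diag Pi QE hQ.
move: (spectralmx Q) (spectral_diag Q) Pu QE Pi Dij => P D Pu QE Pi Dij.
have PP : P *m P^t* = 1%:M by apply/unitarymxP.
rewrite (invmx_unitary Pu) in QE.
have deltaC k l : (delta_mx k l : 'M[C]_n)^t* = delta_mx l k.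
  by rewrite trmx_delta map_delta_mx.
have Dl k l : diag_mx D *m delta_mx k l = D 0 k *: delta_mx k l.
  apply/matrixP => a b; rewrite mul_diag_mx !mxE.
  by case: eqP => [->|] //=; rewrite !mulr0.
have Dr k l : delta_mx k l *m diag_mx D = D 0 l *: delta_mx k l.
  apply/matrixP => a b; rewrite mul_mx_diag !mxE mulrC.
  by case: (b =P l) => [->|] //=; rewrite andbF !mulr0.
have conjM X Y : (P^t* *m X *m P) *m (P^t* *m Y *m P) = P^t* *m (X *m Y) *m P.
  by rewrite !mulmxA -(mulmxA (_ *m X)) PP mulmx1.
exists (P^t* *m delta_mx i j *m P); split.
  by rewrite QE !conjM Dl Dr Dij.
have -> : (P^t* *m delta_mx i j *m P)^t* = P^t* *m delta_mx j i *m P.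
  by rewrite !trmxC_mul trmxCK deltaC mulmxA.
rewrite !conjM !mul_delta_mx.
move=> /(congr1 (fun M => P *m M *m P^t*)).
rewrite !mulmxA PP !mul1mx -!mulmxA PP !mulmx1 => /matrixP/(_ i i)/eqP.
by rewrite !mxE !eqxx (negbTE ij) oner_eq0.
Qed.

(* [T := N^* N - N N^*] commutes with Q, so that [tr (T Q^-1 Z Q) = tr (T Z)];
   hence [tr (T T) = 0], and T is Hermitian. *)
Lemma commutant_normal n (Q N Z W : 'M[C]_n) : Q \in unitmx -> Q^t* = Q ->
    Q *m N = N *m Q ->
    W + Z + N *m N^t* = 0 ->
    W *m invmx Q + invmx Q *m Z + N^t* *m invmx Q *m N = 0 ->
  N *m N^t* = N^t* *m N.
Proof.
move=> Qu Qh QN h1 h2.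
have QN' := hermitian_commutant Qh QN.
have invC M : Q *m M = M *m Q -> invmx Q *m M = M *m invmx Q.
  by move=> h; rewrite -[LHS](mulmxK Qu) -(mulmxA _ M) -h mulKmx.
set T := N^t* *m N - N *m N^t*.
have QT : invmx Q *m T = T *m invmx Q.
  by apply: invC; rewrite mulmxBr mulmxBl !mulmxA QN QN' -!mulmxA QN QN'.
(* Multiply the second relation by [Q] on the right, where [N] passes [Q^-1], and compare with the
   first: the unknown [W] disappears. *)
have TE : T = Z - invmx Q *m Z *m Q.
  have := congr1 (mulmx^~ Q) h2; rewrite mul0mx !mulmxDl mulmxKV //.
  rewrite -(mulmxA (N^t*)) (invC N QN) mulmxA mulmxKV // => h3.
  apply/eqP; rewrite -subr_eq0 -[X in _ == X](subrr 0) -{1}h3 -h1 /T; apply/eqP.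
  move: (N *m _) (_ *m N) (_ *m Q) => a b y.
  by apply/matrixP => i j; rewrite !mxE; ring.
have : \tr (T *m T^t*) = 0.
  rewrite [in T^t*]/T trmxCB !trmxC_mul trmxCK -/T {2}TE mulmxBr raddfB /=.
  rewrite !mulmxA -QT [in X in _ - X]mxtrace_mulC !mulmxA mulmxV // mul1mx.
  exact: subrr.
by move=> /mxtrace_adj_eq0/eqP; rewrite subr_eq0 => /eqP.
Qed.
End Matrices.

Lemma invmx_mul (K : comUnitRingType) n (A B : 'M[K]_n) :
  A \in unitmx -> B \in unitmx -> invmx (A *m B) = invmx B *m invmx A.
Proof.
move=> Au Bu; have ABu : A *m B \in unitmx by rewrite unitmx_mul Au.
by apply: (can_inj (mulKmx ABu)); rewrite mulmxV // !mulmxA mulmxK // mulmxV.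
Qed.

Lemma sum_delta (K : nzRingType) n (f : 'I_n -> K) j :
  \sum_i f i * (i == j)%:R = f j.
Proof.
rewrite (bigD1 j) //= eqxx mulr1 big1 ?addr0 // => i /negbTE ->.
exact: mulr0.
Qed.

(** * The relations of [U_F^+] in terms of [F^* F] *)

Section Relations.
Variables (C : numClosedFieldType) (B : starAlgType C) (d : nat).
Implicit Types (F G : 'M[C]_d) (v w : 'M[B]_d).

Lemma star_sum n (f : 'I_n -> B) : star (\sum_i f i) = \sum_i star (f i).
Proof. exact: (big_morph _ (@starD C B) (@star0 C B)). Qed.

Lemma adj_mxM v w : adj_mx (v *m w) = adj_mx w *m adj_mx v.
Proof.
apply/matrixP => i j; rewrite !mxE star_sum; apply: eq_bigr => k _.
by rewrite !mxE starM.
Qed.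

Lemma adj_scalars_mx F : adj_mx (scalars_mx B F) = scalars_mx B (F^t*).
Proof. by apply/matrixP => i j; rewrite !mxE starZ star1. Qed.

Lemma adj_mxK : involutive (@adj_mx C B d).
Proof. by move=> v; apply/matrixP => i j; rewrite !mxE starK. Qed.

Lemma adj_bar_mx v : adj_mx (bar_mx v) = v^T.
Proof. by apply/matrixP => i j; rewrite !mxE starK. Qed.

Lemma scalars_mxK F : F \in unitmx ->
  scalars_mx B F *m scalars_mx B (invmx F) = 1%:M.
Proof. by move=> Fu; rewrite -scalars_mxM mulmxV // scalars_mx1. Qed.

Lemma scalars_mxVK F : F \in unitmx ->
  scalars_mx B (invmx F) *m scalars_mx B F = 1%:M.
Proof. by move=> Fu; rewrite -scalars_mxM mulVmx // scalars_mx1. Qed.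

(** This is one half of the unitarity of [F (bar v) F^-1]: the adjoint of [bar v] is [v^T], and the
    outer factors [F] and [F^*] are cancelled. In this form the entries are combinations of products
    [star (v j l) * v k m], on which a Schürmann functional can be evaluated. *)
Lemma UF_relations_barE F v : F \in unitmx -> UF_relations F v ->
  bar_mx v *m scalars_mx B (invmx (F^t* *m F)) *m v^T =
  scalars_mx B (invmx (F^t* *m F)).
Proof.
move=> Fu [_ [h _]].
have Fau : F^t* \in unitmx by rewrite map_unitmx unitmx_tr.
rewrite invmx_mul // scalars_mxM !mulmxA.
move: h; rewrite !adj_mxM adj_bar_mx !adj_scalars_mx trmxC_inv !mulmxA.
move=> /(congr1 (fun M =>
  scalars_mx B (invmx F) *m M *m scalars_mx B (invmx (F^t*)))).
rewrite !mulmxA scalars_mxVK // mul1mx mulmx1 => <-.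
by rewrite -[RHS]mulmxA scalars_mxK // mulmx1.
Qed.

Lemma unitary_conj_scalars F v : F \in unitmx -> unitary_mx v ->
  scalars_mx B (F^t* *m F) *m v = v *m scalars_mx B (F^t* *m F) ->
  unitary_mx (scalars_mx B F *m v *m scalars_mx B (invmx F)).
Proof.
move=> Fu [vv' v'v] Qv.
have Fau : F^t* \in unitmx by rewrite map_unitmx unitmx_tr.
have FF := scalars_mxK Fu; have FF' := scalars_mxVK Fu.
have GG := scalars_mxK Fau; have GG' := scalars_mxVK Fau.
rewrite scalars_mxM in Qv.
rewrite /unitary_mx !adj_mxM !adj_scalars_mx trmxC_inv !mulmxA.
move: (scalars_mx B F) (scalars_mx B (invmx F)) (scalars_mx B (F^t*))
  (scalars_mx B (invmx (F^t*))) FF FF' GG GG' Qv => f f' g g' FF FF' GG GG' Qv.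
have Qv' : v *m f' *m g' = f' *m g' *m v.
  have qq : (f' *m g') *m (g *m f) = 1%:M.
    by rewrite mulmxA -(mulmxA f') GG' mulmx1 FF'.
  have qq' : (g *m f) *m (f' *m g') = 1%:M.
    by rewrite mulmxA -(mulmxA g) FF mulmx1 GG.
  rewrite -mulmxA -[LHS]mul1mx -[in LHS]qq -mulmxA (mulmxA _ v) Qv.
  by rewrite -(mulmxA v) qq' mulmx1.
split.
- rewrite -(mulmxA f v) -(mulmxA f) Qv' !mulmxA FF mul1mx -(mulmxA g') vv'.
  by rewrite mulmx1 GG'.
- rewrite -(mulmxA _ g f) -(mulmxA _ (g *m f) v) Qv mulmxA -(mulmxA g') v'v.
  by rewrite mulmx1 mulmxA GG' mul1mx FF.
Qed.
End Relations.

(** * Normality forced by a completing functional *)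

Section Obstruction.
Variables (R : realType) (d : nat) (F : 'M[R[i]]_d) (Fu : F \in unitmx).
Local Notation A := (Pol Fu).
Local Notation u := (pol_gen Fu).
Local Notation Q := (F^t* *m F).

Variables (H : hilbertType R) (rho : representation A H) (eta : A -> H).
Variable psi : A -> R[i].
Hypothesis psiP : schurmann_triple (counit Fu) rho eta psi.

Let psiD a b : psi (a + b) = psi a + psi b.
Proof. by have [_ /(_ 1 a b) + _] := psiP; rewrite scale1r mul1r. Qed.

Let psi0 : psi 0 = 0.
Proof. by apply: (addrI (psi 0)); rewrite -psiD !addr0. Qed.

Let psiZ c a : psi (c *: a) = c * psi a.
Proof. by have [_ /(_ c a 0) + _] := psiP; rewrite psi0 !addr0. Qed.

Lemma cocycle_eta1 : eta 1 = 0.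
Proof.
have [[_ h] _ _] := psiP; move: (h 1 1).
rewrite mulr1 rep1 rmorph1 scale1r => {}h.
by apply: (addrI (eta 1)); rewrite -h addr0.
Qed.

Lemma schurmann_psi1 : psi 1 = 0.
Proof.
have [_ _ /(_ 1 1)] := psiP.
rewrite mulr1 rmorph1 mulr1 mul1r star1 cocycle_eta1 inner0r addr0 => h.
by apply: (addrI (psi 1)); rewrite -h addr0.
Qed.

Let psi_sum n (f : 'I_n -> A) : psi (\sum_i f i) = \sum_i psi (f i).
Proof. exact: (big_morph _ psiD psi0). Qed.

Let psi_bool (b : bool) : psi b%:R = 0.
Proof. by case: b; rewrite ?schurmann_psi1 ?psi0. Qed.

(** The relations see the cocycle only through inner products of the [eta (u j k)], so one argument
    serves Gaussian cocycles, cocycles for [u |-> -I] and projected cocycles. Applying [psi] to both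
    relations gives linear equations in its unknown values on the generators and their stars, and
    [commutant_normal] with [N = B^T] concludes. *)
Lemma completable_normal (B : 'M[R[i]]_d) :
    (forall j k l m, inner (eta (u j k)) (eta (u l m)) = (B j k)^* * B l m) ->
    Q *m B^T = B^T *m Q ->
  B^T *m B^T^t* = B^T^t* *m B^T.
Proof.
move=> etaE QB.
have [_ _ psiM] := psiP.
have [[_ uu] _] := pol_gen_relations Fu.
have rel2 := UF_relations_barE Fu (pol_gen_relations Fu).
have epsu j k : counit Fu (u j k) = (j == k)%:R by exact: counitE.
have epsu' j k : counit Fu (star (u j k)) = (j == k)%:R.
  by rewrite star_morphismP epsu /star /= conjC_nat.
have Fau : F^t* \in unitmx by rewrite map_unitmx unitmx_tr.
have psiMu j k l m : psi (star (u j k) * u l m) =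
    psi (star (u j k)) * (l == m)%:R + (j == k)%:R * psi (u l m)
    + (B j k)^* * B l m.
  by rewrite psiM epsu epsu' starK etaE.
move: (pol_gen Fu) uu rel2 psiMu {etaE epsu epsu'} => g uu rel2 psiMu.
(* [Z] carries a transposition because the right factor of the second relation is [u^T]. *)
pose Z : 'M[R[i]]_d := \matrix_(j, k) psi (g k j).
pose W : 'M[R[i]]_d := \matrix_(j, k) psi (star (g j k)).
apply: (@commutant_normal _ _ Q _ Z W) => //.
- by rewrite unitmx_mul Fau.
- exact: hermitian_gram.
- apply/matrixP => j k; rewrite !mxE.
  (* The indices are exchanged: entry [(k, j)] of [B^* B] is entry [(j, k)] of [N N^*] for
     [N = B^T]. *)
  move/matrixP/(_ k j): uu => /(congr1 psi); rewrite !mxE psi_sum psi_bool => h.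
  rewrite -[RHS]h {h}.
  (* The two terms without a sum become sums against a Kronecker delta, so that the two sides can be
     compared term by term. *)
  rewrite -[psi (star _)](sum_delta (fun i => psi (star (g i k))) j).
  rewrite -[psi (g k j)](sum_delta (fun i => psi (g i j)) k) -!big_split /=.
  apply: eq_bigr => i _.
  by rewrite !mxE psiMu [_ * psi _]mulrC [_^* * _]mulrC.
- apply/matrixP => j k; rewrite [in RHS]mxE.
  move/matrixP/(_ j k): rel2 => /(congr1 psi).
  set q := invmx Q; rewrite mxE psi_sum [X in _ = psi X]mxE.
  rewrite psiZ schurmann_psi1 mulr0.
  move=> h; rewrite !mxE -[RHS]h {h}.
  rewrite -(sum_delta (fun m => \sum_l W j l * q l m) k).
  rewrite -!big_split /=; apply: eq_bigr => m _.
  rewrite -[q j m](sum_delta (q ^~ m) j) !mxE !mulr_suml psi_sum -!big_split /=.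
  apply: eq_bigr => l _; rewrite !mxE.
  rewrite [RHS](_ : _ = q l m * psi (star (g j l) * g k m)); last first.
    by rewrite -psiZ -scalerAr mulr1 -scalerAl.
  rewrite psiMu (eq_sym j l) (eq_sym k m).
  by ring.
Qed.
End Obstruction.

(** * A triangular star-algebra encoding two cocycles and a functional *)

Section TriangularAlgebra.
Variable C : numClosedFieldType.

(* [Tri x r b1 b2 c1 c2 z] stands for the matrix
     [ x b1 b2 z  ]
     [ 0 x  0  c1 ]
     [ 0 0  r  c2 ]
     [ 0 0  0  x  ]
   and the involution is the adjoint for the indefinite form that swaps the
   first and the last coordinate. *)
Record tri : Type := Tri {
  tri_x : C; tri_r : C; tri_b1 : C; tri_b2 : C; tri_c1 : C; tri_c2 : C;
  tri_z : C
}.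

HB.instance Definition _ := gen_eqMixin tri.
HB.instance Definition _ := gen_choiceMixin tri.

Definition tri_zero : tri := Tri 0 0 0 0 0 0 0.

Definition tri_add (s t : tri) : tri :=
  Tri (tri_x s + tri_x t) (tri_r s + tri_r t) (tri_b1 s + tri_b1 t)
    (tri_b2 s + tri_b2 t) (tri_c1 s + tri_c1 t) (tri_c2 s + tri_c2 t)
    (tri_z s + tri_z t).

Definition tri_scale (k : C) (s : tri) : tri :=
  Tri (k * tri_x s) (k * tri_r s) (k * tri_b1 s) (k * tri_b2 s) (k * tri_c1 s)
    (k * tri_c2 s) (k * tri_z s).

Definition tri_one : tri := Tri 1 1 0 0 0 0 0.

Definition tri_mul (s t : tri) : tri :=
  Tri (tri_x s * tri_x t) (tri_r s * tri_r t)
    (tri_x s * tri_b1 t + tri_b1 s * tri_x t)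
    (tri_x s * tri_b2 t + tri_b2 s * tri_r t)
    (tri_x s * tri_c1 t + tri_c1 s * tri_x t)
    (tri_r s * tri_c2 t + tri_c2 s * tri_x t)
    (tri_x s * tri_z t + tri_b1 s * tri_c1 t + tri_b2 s * tri_c2 t
      + tri_z s * tri_x t).

Definition tri_star (s : tri) : tri :=
  Tri (tri_x s)^* (tri_r s)^* (tri_c1 s)^* (tri_c2 s)^* (tri_b1 s)^*
    (tri_b2 s)^* (tri_z s)^*.

Local Ltac tri_ring :=
  move=> *; repeat match goal with s : tri |- _ => destruct s end;
  rewrite /tri_mul /tri_add /tri_scale /=; congr Tri; ring.

Fact tri_addA : associative tri_add. Proof. tri_ring. Qed.
Fact tri_addC : commutative tri_add. Proof. tri_ring. Qed.
Fact tri_add0 : left_id tri_zero tri_add. Proof. tri_ring. Qed.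
Fact tri_addN : left_inverse tri_zero (tri_scale (-1)) tri_add.
Proof. tri_ring. Qed.

HB.instance Definition _ :=
  GRing.isZmodule.Build tri tri_addA tri_addC tri_add0 tri_addN.

Fact tri_scaleA (k l : C) (s : tri) :
  tri_scale k (tri_scale l s) = tri_scale (k * l) s.
Proof. tri_ring. Qed.
Fact tri_scale1 : left_id 1 tri_scale. Proof. tri_ring. Qed.
Fact tri_scaleDr : right_distributive tri_scale tri_add. Proof. tri_ring. Qed.
Fact tri_scaleDl (s : tri) :
  {morph tri_scale^~ s : k l / k + l >-> tri_add k l}.
Proof. tri_ring. Qed.

HB.instance Definition _ := GRing.Zmodule_isLmodule.Build C tri
  tri_scaleA tri_scale1 tri_scaleDr tri_scaleDl.

Fact tri_mulA : associative tri_mul. Proof. tri_ring. Qed.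
Fact tri_mul1 : left_id tri_one tri_mul. Proof. tri_ring. Qed.
Fact tri_mulr1 : right_id tri_one tri_mul. Proof. tri_ring. Qed.
Fact tri_mulDl : left_distributive tri_mul tri_add. Proof. tri_ring. Qed.
Fact tri_mulDr : right_distributive tri_mul tri_add. Proof. tri_ring. Qed.
Fact tri_one_neq0 : tri_one != tri_zero.
Proof. by apply/eqP => -[/eqP]; rewrite oner_eq0. Qed.

HB.instance Definition _ := GRing.Zmodule_isNzRing.Build tri
  tri_mulA tri_mul1 tri_mulr1 tri_mulDl tri_mulDr tri_one_neq0.

Fact tri_scaleAl (k : C) (s t : tri) :
  tri_scale k (tri_mul s t) = tri_mul (tri_scale k s) t.
Proof. tri_ring. Qed.

HB.instance Definition _ := GRing.Lmodule_isLalgebra.Build C tri tri_scaleAl.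

Fact tri_scaleAr (k : C) (s t : tri) :
  tri_scale k (tri_mul s t) = tri_mul s (tri_scale k t).
Proof. tri_ring. Qed.

HB.instance Definition _ := GRing.Lalgebra_isAlgebra.Build C tri tri_scaleAr.

Fact tri_starK : involutive tri_star.
Proof. by case=> *; rewrite /tri_star /= !conjCK. Qed.

Fact tri_starM (s t : tri) :
  tri_star (tri_mul s t) = tri_mul (tri_star t) (tri_star s).
Proof.
case: s t => [? ? ? ? ? ? ?] [? ? ? ? ? ? ?].
by rewrite /tri_star /tri_mul /= !rmorphD !rmorphM /=; congr Tri; ring.
Qed.

Fact tri_starP (k : C) (s t : tri) :
  tri_star (tri_add (tri_scale k s) t) =
  tri_add (tri_scale k^* (tri_star s)) (tri_star t).
Proof. by rewrite /tri_star /tri_add /= !rmorphD !rmorphM. Qed.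

HB.instance Definition _ := hasStar.Build C tri tri_starK tri_starM tri_starP.

Fact tri_x_linear : linear (tri_x : tri -> C^o). Proof. by []. Qed.
Fact tri_r_linear : linear (tri_r : tri -> C^o). Proof. by []. Qed.
Fact tri_x_monoid : monoid_morphism (tri_x : tri -> C^o). Proof. by []. Qed.
Fact tri_r_monoid : monoid_morphism (tri_r : tri -> C^o). Proof. by []. Qed.

HB.instance Definition _ := GRing.isLinear.Build C tri C^o _ tri_x tri_x_linear.
HB.instance Definition _ :=
  GRing.isMonoidMorphism.Build tri C^o tri_x tri_x_monoid.
HB.instance Definition _ := GRing.isLinear.Build C tri C^o _ tri_r tri_r_linear.
HB.instance Definition _ :=
  GRing.isMonoidMorphism.Build tri C^o tri_r tri_r_monoid.

Fact tri_x_star (s : tri) : (tri_x (star s) : C^o) = star (tri_x s : C^o).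
Proof. by []. Qed.
Fact tri_r_star (s : tri) : (tri_r (star s) : C^o) = star (tri_r s : C^o).
Proof. by []. Qed.

(** Once [tri_x] is identified with the counit, this is the identity of a Gaussian cocycle; the next
    two lemmas make [tri_c2] a cocycle for the character [tri_r] and [tri_z] a completing
    functional. *)
Lemma tri_c1M s t :
  tri_c1 (s * t) = tri_x s * tri_c1 t + tri_x t * tri_c1 s.
Proof. by rewrite [_ * tri_c1 s]mulrC. Qed.

Lemma tri_c2M s t :
  tri_c2 (s * t) = tri_r s * tri_c2 t + tri_x t * tri_c2 s.
Proof. by rewrite [_ * tri_c2 s]mulrC. Qed.

(** The entries [b1], [b2] of [s] are the conjugates of [c1], [c2] of [star s], so the row-by-column
    products in the corner are inner products of cocycle values. *)
Lemma tri_zM s t : tri_z (s * t) = tri_z s * tri_x t + tri_x s * tri_z t +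
  ((tri_c1 (star s))^* * tri_c1 t + (tri_c2 (star s))^* * tri_c2 t).
Proof.
by rewrite /= !conjCK -[LHS]/(tri_z (tri_mul s t)) /tri_mul /=; ring.
Qed.


Lemma tri_starE x r b1 b2 c1 c2 z : star (Tri x r b1 b2 c1 c2 z) =
  Tri x^* r^* c1^* c2^* b1^* b2^* z^*.
Proof. by []. Qed.

Section TriMatrices.
Variable d : nat.
Definition tri_mx (X Y B1 B2 C1 C2 Z : 'M[C]_d) : 'M[tri]_d := \matrix_(i, j)
  Tri (X i j) (Y i j) (B1 i j) (B2 i j) (C1 i j) (C2 i j) (Z i j).

Lemma tri_sum n (x r b1 b2 c1 c2 z : 'I_n -> C) :
  \sum_i Tri (x i) (r i) (b1 i) (b2 i) (c1 i) (c2 i) (z i) =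
  Tri (\sum_i x i) (\sum_i r i) (\sum_i b1 i) (\sum_i b2 i)
    (\sum_i c1 i) (\sum_i c2 i) (\sum_i z i).
Proof.
rewrite unlock; elim: (index_enum _) => //= i s ->.
by [].
Qed.

Lemma tri_mxM (X Y B1 B2 C1 C2 Z X' Y' B1' B2' C1' C2' Z' : 'M[C]_d) :
  tri_mx X Y B1 B2 C1 C2 Z *m tri_mx X' Y' B1' B2' C1' C2' Z' =
  tri_mx (X *m X') (Y *m Y') (X *m B1' + B1 *m X') (X *m B2' + B2 *m Y')
    (X *m C1' + C1 *m X') (Y *m C2' + C2 *m X')
    (X *m Z' + B1 *m C1' + B2 *m C2' + Z *m X').
Proof.
apply/matrixP => i j; rewrite !mxE -!big_split /= -tri_sum.
by apply: eq_bigr => k _; rewrite !mxE.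
Qed.

Lemma tri_mx1 : tri_mx 1%:M 1%:M 0 0 0 0 0 = 1%:M.
Proof. by apply/matrixP => i j; rewrite !mxE; case: eqP. Qed.

Lemma tri_mx_scalars (X : 'M[C]_d) : scalars_mx tri X = tri_mx X X 0 0 0 0 0.
Proof.
apply/matrixP => i j; rewrite !mxE /GRing.scale /= /tri_scale /=.
by rewrite !mulr1 !mulr0.
Qed.

Lemma tri_mx_adj (X Y B1 B2 C1 C2 Z : 'M[C]_d) :
  adj_mx (tri_mx X Y B1 B2 C1 C2 Z) =
  tri_mx (X^t*) (Y^t*) (C1^t*) (C2^t*) (B1^t*) (B2^t*) (Z^t*).
Proof. by apply/matrixP => i j; rewrite !mxE. Qed.

Lemma tri_mx_tr (X Y B1 B2 C1 C2 Z : 'M[C]_d) : (tri_mx X Y B1 B2 C1 C2 Z)^T =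
  tri_mx X^T Y^T B1^T B2^T C1^T C2^T Z^T.
Proof. by apply/matrixP => i j; rewrite !mxE. Qed.

(* The columns c1, c2 carry the cocycles with matrices A and A^*; the rows b1,
   b2 and the corner z are then forced by unitarity. *)
Definition tri_gen (A : 'M[C]_d) : 'M[tri]_d :=
  tri_mx 1%:M (- 1%:M) (- A^t*) A A (A^t*)
    (- (2^-1 *: (A *m A^t* + A^t* *m A))).

(** The opposite signs in rows and columns cancel the off-diagonal blocks, and both products have
    the corner [2 Z + A^* A + A A^*], whence the factor one half in [tri_gen]. *)
Lemma tri_gen_unitary A : unitary_mx (tri_gen A).
Proof.
rewrite /unitary_mx /tri_gen tri_mx_adj.
set Z := - (_ *: _).
have -> : Z^t* = Z.
  rewrite /Z trmxCN trmxCZ trmxCD !trmxC_mul trmxCK.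
  by rewrite geC0_conj ?invr_ge0 ?ler0n.
have ZE : Z + A^t* *m A + A *m A^t* + Z = 0.
  rewrite -(addrA Z) addrAC [A^t* *m A + _]addrC.
  rewrite -opprD -scalerDl -mulr2n -[_ *+ 2]mulr_natr mulVf ?pnatr_eq0 //.
  by rewrite scale1r addNr.
rewrite !trmxCN trmxC1 trmxCK.
split; rewrite tri_mxM !(mul1mx, mulmx1, mulNmx, mulmxN) ?opprK -tri_mx1.
  by rewrite ZE !subrr !addNr.
by rewrite ZE !subrr !addNr.
Qed.

(** The entrywise star of [tri_gen N^T] is the adjoint of [tri_gen N], hence unitary. Its blocks are
    polynomials in [N] and [N^*], so they commute with [Q] and [unitary_conj_scalars] applies. *)
Lemma tri_gen_UF (F : 'M[C]_d) N : F \in unitmx ->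
    (F^t* *m F) *m N = N *m (F^t* *m F) -> UF_relations F (tri_gen N^T).
Proof.
move=> Fu QN; split; first exact: tri_gen_unitary.
set Q := F^t* *m F in QN *.
have QN' : Q *m N^t* = N^t* *m Q.
  by apply: hermitian_commutant QN; exact: hermitian_gram.
(* Transposition exchanges the two products; the corner fits only because it is symmetric in them.
   This is where the defects of the two cocycles cancel. *)
have ZT : (- (2^-1 *: (N^T *m N^T^t* + N^T^t* *m N^T)))^T =
    - (2^-1 *: (N *m N^t* + N^t* *m N)).
  apply/matrixP => i j; rewrite !mxE; congr (- (_ * _)); rewrite addrC.
  by congr (_ + _); apply: eq_bigr => k _; rewrite !mxE mulrC.
have -> : bar_mx (tri_gen N^T) = adj_mx (tri_gen N).
  rewrite -[LHS]trmxK -/(adj_mx _) /tri_gen !tri_mx_adj tri_mx_tr -ZT !map_trmx.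
  by congr tri_mx; rewrite ?trmxK ?trmx1 ?linearN /= ?trmx1 ?trmxK.
apply: unitary_conj_scalars => //.
  by have [uu' u'u] := tri_gen_unitary N; split; rewrite adj_mxK.
rewrite -/Q; clearbody Q; rewrite /tri_gen tri_mx_adj tri_mx_scalars !tri_mxM.
rewrite !(mul0mx, mulmx0, addr0, add0r) trmxC1 !trmxCN !trmxCK trmxC1.
rewrite trmxCZ trmxCD !trmxC_mul trmxCK !mulmxN !mulNmx mulmx1 mul1mx QN QN'.
congr tri_mx; rewrite -scalemxAr -scalemxAl mulmxDr mulmxDl !mulmxA QN QN'.
by rewrite -!mulmxA QN QN'.
Qed.

End TriMatrices.
End TriangularAlgebra.

(** * Complex row vectors as a Hilbert space *)

Section EuclideanSpace.
Variable R : realType.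

(** Squared distances are used because [hsq] dominates the squares of the real and imaginary parts
    of each coordinate. *)
Lemma real_cauchy_sq (f : nat -> R) :
    (forall e, 0 < e -> exists N, forall m n, (N <= m)%N -> (N <= n)%N ->
      (f m - f n) ^+ 2 < e) ->
  exists l, forall e, 0 < e -> exists N, forall n, (N <= n)%N ->
    (f n - l) ^+ 2 < e.
Proof.
have sqr_lt (x e : R) : 0 < e -> (x ^+ 2 < e ^+ 2) = (`|x| < e).
  by move=> e0; rewrite -real_normK ?num_real // ltr_pXn2r ?nnegrE // ltW.
move=> fC; have : cvg (f @ \oo)%classic.
  apply/cauchy_cvgP/cauchy_exP => e e0.
  have [N hN] := fC (e ^+ 2) (exprn_gt0 2 e0).
  exists (f N), N => // n /= Nn; rewrite /ball /= -sqr_lt //.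
  exact: hN.
move=> /cvgrPdist_lt h; exists (lim (f @ \oo)%classic) => e e0.
have [|N _ hN] := h (Num.sqrt e); first by rewrite sqrtr_gt0.
exists N => n /hN; rewrite distrC -sqr_lt ?sqrtr_gt0 // sqr_sqrtr //.
exact: ltW.
Qed.

Variable n : nat.
Implicit Types x y z : 'rV[R[i]]_n.

Definition row_inner x y : R[i] := \sum_j (x 0 j)^* * y 0 j.

Fact row_inner_linear x (c : R[i]) y z :
  row_inner x (c *: y + z) = c * row_inner x y + row_inner x z.
Proof.
rewrite /row_inner mulr_sumr -big_split; apply: eq_bigr => j _.
by rewrite !mxE mulrDr mulrCA.
Qed.

Fact row_innerC x y : row_inner y x = (row_inner x y)^*.
Proof.
rewrite /row_inner rmorph_sum; apply: eq_bigr => j _.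
by rewrite rmorphM /= conjCK mulrC.
Qed.

Fact row_inner_ge0 x : 0 <= row_inner x x.
Proof. by apply: sumr_ge0 => j _; rewrite mulrC mul_conjC_ge0. Qed.

Fact row_inner_eq0 x : row_inner x x = 0 -> x = 0.
Proof.
move/eqP; rewrite psumr_eq0 => [/allP h|j _]; last first.
  by rewrite mulrC mul_conjC_ge0.
apply/rowP => j; rewrite mxE; apply/eqP; rewrite -mul_conjC_eq0 mulrC.
exact: h (mem_index_enum _).
Qed.

HB.instance Definition _ := hasInner.Build R 'rV[R[i]]_n row_inner_linear
  row_innerC row_inner_ge0 row_inner_eq0.

Lemma row_hsq x :
  hsq x = \sum_j (complex.Re (x 0 j) ^+ 2 + complex.Im (x 0 j) ^+ 2).
Proof.
rewrite /hsq /inner /= /row_inner raddf_sum; apply: eq_bigr => j _ /=.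
by case: (x 0 j) => a b /=; ring.
Qed.

Fact row_complete (u : nat -> 'rV[R[i]]_n) : hcauchy u -> exists l, hcvg u l.
Proof.
move=> uC.
have hsq_ge j x :
    complex.Re (x 0 j) ^+ 2 <= hsq x /\ complex.Im (x 0 j) ^+ 2 <= hsq x.
  rewrite row_hsq (bigD1 j) //=.
  set s := \sum_(_ | _) _; have : 0 <= s.
    by apply: sumr_ge0 => k _; rewrite addr_ge0 ?sqr_ge0.
  have := sqr_ge0 (complex.Re (x 0 j)); have := sqr_ge0 (complex.Im (x 0 j)).
  by move=> *; split; lra.
have uC2 e : 0 < e -> exists N, forall m k, (N <= m)%N -> (N <= k)%N ->
    hsq (u m - u k) < e.
  move=> e0; have [|N hN] := uC (Num.sqrt e); first by rewrite sqrtr_gt0.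
  exists N => m k Nm Nk; have := hN m k Nm Nk.
  by rewrite hnorm_lt ?sqrtr_gt0 // sqr_sqrtr // ltW.
have /choice[a ha] j : exists l, forall e, 0 < e -> exists N,
    forall k, (N <= k)%N -> (complex.Re (u k 0 j) - l) ^+ 2 < e.
  apply: real_cauchy_sq => e /uC2[N hN]; exists N => m k Nm Nk.
  apply: le_lt_trans (hN m k Nm Nk); rewrite -raddfB.
  by have [+ _] := hsq_ge j (u m - u k); rewrite !mxE.
have /choice[b hb] j : exists l, forall e, 0 < e -> exists N,
    forall k, (N <= k)%N -> (complex.Im (u k 0 j) - l) ^+ 2 < e.
  apply: real_cauchy_sq => e /uC2[N hN]; exists N => m k Nm Nk.
  apply: le_lt_trans (hN m k Nm Nk); rewrite -raddfB.
  by have [_ +] := hsq_ge j (u m - u k); rewrite !mxE.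
exists (\row_j (a j +i* b j)%C) => e e0.
(* Each of the [n] coordinates contributes at most [2 d = e^2 / (n + 1)]; dividing by [n + 1] keeps
   the final bound strict and covers [n = 0]. *)
pose d := e ^+ 2 / (2 * n.+1%:R).
have d0 : 0 < d by rewrite divr_gt0 ?exprn_gt0 // mulr_gt0 ?ltr0n.
have /choice[N hN] j : exists N, forall k, (N <= k)%N ->
    (complex.Re (u k 0 j) - a j) ^+ 2 + (complex.Im (u k 0 j) - b j) ^+ 2
      < d + d.
  have [N1 h1] := ha j d d0; have [N2 h2] := hb j d d0.
  exists (maxn N1 N2) => k; rewrite geq_max => /andP[/h1 h /h2 h'].
  exact: ltrD.
exists (\max_j N j) => k Nk; rewrite hnorm_lt // row_hsq.
apply: (@le_lt_trans _ _ (\sum_(j < n) (d + d))).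
  apply: ler_sum => j _; apply/ltW.
  have := hN j k (leq_trans (leq_bigmax j) Nk).
  by rewrite !mxE !raddfB.
rewrite sumr_const card_ord -[_ *+ n]mulr_natr.
have -> : e ^+ 2 = (d + d) * n.+1%:R.
  have : n.+1%:R != 0 :> R by rewrite pnatr_eq0.
  by rewrite /d; move: n.+1%:R => K K0; field.
by rewrite ltr_pM2l ?addr_gt0 // ltr_nat.
Qed.

HB.instance Definition _ :=
  PreHilbert_isComplete.Build R 'rV[R[i]]_n row_complete.

End EuclideanSpace.

(** * Representations that are direct sums of characters *)

Section DiagonalRepresentation.
Variables (R : realType) (A : starAlgType R[i]) (n : nat).
Variable chi : 'I_n -> character A.

Definition diag_op (a : A) (x : 'rV[R[i]]_n) : 'rV[R[i]]_n :=
  \row_j ((chi j a : R[i]) * x 0 j).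

Fact diag_op_linear a : linear (diag_op a).
Proof.
by move=> c x y; apply/rowP => j; rewrite !mxE mulrDr mulrCA.
Qed.

HB.instance Definition _ a := GRing.isLinear.Build R[i] 'rV[R[i]]_n 'rV[R[i]]_n
  _ (diag_op a) (diag_op_linear a).

Fact diag_op_bounded a :
  exists M : R, forall x, hnorm (diag_op a x) <= M * hnorm x.
Proof.
(* The Euclidean norm of the vector of character values bounds each of them, hence also the
   operator. *)
pose w : 'rV[R[i]]_n := \row_j (chi j a : R[i]).
exists (hnorm w) => x; rewrite /hnorm -sqrtrM ?hsq_ge0 //.
apply: ler_wsqrtr; rewrite -![complex.Re _]/(hsq _) -lecR rmorphM /= -!hsqE.
rewrite /inner /= /row_inner mulr_suml; apply: ler_sum => j _.
rewrite !mxE rmorphM /= mulrACA; apply: ler_wpM2l.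
  by rewrite mulrC mul_conjC_ge0.
by rewrite (bigD1 j) //= lerDl sumr_ge0 // => k _; rewrite mulrC mul_conjC_ge0.
Qed.

Fact diag_op_rep (c : R[i]) a b x :
  diag_op (c *: a + b) x = c *: diag_op a x + diag_op b x.
Proof. by apply/rowP => j; rewrite !mxE linearP mulrDl mulrA. Qed.

Fact diag_op1 x : diag_op 1 x = x.
Proof. by apply/rowP => j; rewrite !mxE rmorph1 mul1r. Qed.

Fact diag_opM a b x : diag_op (a * b) x = diag_op a (diag_op b x).
Proof. by apply/rowP => j; rewrite !mxE rmorphM mulrA. Qed.

Fact diag_op_star a x y :
  inner (diag_op (star a) x) y = inner x (diag_op a y).
Proof.
apply: eq_bigr => j _; rewrite !mxE star_morphismP rmorphM /= conjCK.
by rewrite mulrCA mulrA.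
Qed.

Definition diag_rep : representation A 'rV[R[i]]_n :=
  @Representation R A 'rV[R[i]]_n (fun a => diag_op a) diag_op_bounded
    diag_op_rep diag_op1 diag_opM diag_op_star.
End DiagonalRepresentation.

Definition comp_star (C : numClosedFieldType) (A B D : starAlgType C)
    (g : starMorphism B D) (f : starMorphism A B) : starMorphism A D.
Proof.
apply: (@StarMorphism C A D (g \o f)) => a.
by rewrite /= !star_morphismP.
Defined.

(** The difference [z] of the two candidates lies in [V] and is also a difference of two vectors
    orthogonal to [V], so it is orthogonal to itself. *)
Lemma proj_unique (R : realType) (H : hilbertType R) (V : closedSubspace H)
    (x y : H) : y \in csub_pred V -> x - y \in csub_pred (orth V) ->
  val (proj V x) = y.
Proof.
move=> yV /asboolP xy; apply/eqP; rewrite -subr_eq0; apply/eqP.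
pose z : Defs.subspace V := proj V x - Subspace yV.
have zE : val z = val (proj V x) - y by rewrite linearB.
apply: inner_eq0; rewrite -zE {2}zE.
have -> : val (proj V x) - y = (x - y) - (x - val (proj V x)).
  by rewrite opprB [RHS]addrC addrA subrK.
by rewrite innerBr xy projP subrr.
Qed.

(** If all these minors vanished, then [A j k * A^* k m = A k m * A^* j k], and summing over [k]
    would give normality. It provides two generators on which the two cocycles of the direct sum are
    linearly independent. *)
Lemma non_normal_independent (C : numClosedFieldType) n (A : 'M[C]_n) :
    A *m A^t* <> A^t* *m A ->
  exists j k l m, A j k * A^t* l m != A l m * A^t* j k.
Proof.
move=> An; apply: contra_notP An => h; apply/matrixP => j m; rewrite !mxE.
apply: eq_bigr => k _; rewrite [RHS]mulrC; apply/eqP/negPn/negP => ne.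
by apply: h; exists j, k, k, m.
Qed.

(** * Failure of the three properties, given a non-normal [N] commuting with [F^* F] *)

Section NonNormalCommutant.
Variables (R : realType) (d : nat) (F : 'M[R[i]]_d) (Fu : F \in unitmx).
Variable N : 'M[R[i]]_d.
Hypothesis QN : F^t* *m F *m N = N *m (F^t* *m F).
Hypothesis Nn : N *m N^t* <> N^t* *m N.

Local Notation A := (Pol Fu).
Local Notation u := (pol_gen Fu).

(** The coordinates of this single morphism yield the counit, the character of [u |-> -I], both
    cocycles and the functional; their identities all follow from its multiplicativity. *)
Definition tri_rep : starMorphism A (tri R[i]) :=
  pol_lift Fu (tri_gen_UF Fu QN).

Lemma tri_repE j k : tri_rep (u j k) = tri_gen N^T j k.
Proof. exact: pol_liftE. Qed.

Definition sign_char : character A :=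
  comp_star (StarMorphism (@tri_r_star R[i])) tri_rep.

Definition gauss_coord (a : A) : R[i] := tri_c1 (tri_rep a).
Definition sign_coord (a : A) : R[i] := tri_c2 (tri_rep a).
Definition tri_functional (a : A) : R[i] := tri_z (tri_rep a).

Lemma tri_x_counit a : tri_x (tri_rep a) = counit Fu a.
Proof.
have := @pol_morphism_eq _ _ F Fu _
  (comp_star (StarMorphism (@tri_x_star R[i])) tri_rep) (counit Fu).
apply=> j k; rewrite counitE /= tri_repE mxE /=.
by rewrite mxE.
Qed.

Lemma sign_charE j k : (sign_char (u j k) : R[i]) = - (j == k)%:R.
Proof. by rewrite /= tri_repE !mxE. Qed.

Lemma gauss_coord_gen j k : gauss_coord (u j k) = N^T j k.
Proof. by rewrite /gauss_coord tri_repE mxE. Qed.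

Lemma sign_coord_gen j k : sign_coord (u j k) = N^T^t* j k.
Proof. by rewrite /sign_coord tri_repE mxE. Qed.

Lemma gauss_coord_linear (c : R[i]) a b :
  gauss_coord (c *: a + b) = c * gauss_coord a + gauss_coord b.
Proof. by rewrite /gauss_coord linearP. Qed.

Lemma sign_coord_linear (c : R[i]) a b :
  sign_coord (c *: a + b) = c * sign_coord a + sign_coord b.
Proof. by rewrite /sign_coord linearP. Qed.

Lemma gauss_coordM a b : gauss_coord (a * b) =
  counit Fu a * gauss_coord b + counit Fu b * gauss_coord a.
Proof. by rewrite /gauss_coord rmorphM tri_c1M !tri_x_counit. Qed.

Lemma sign_coordM a b : sign_coord (a * b) =
  sign_char a * sign_coord b + counit Fu b * sign_coord a.
Proof. by rewrite /sign_coord rmorphM tri_c2M tri_x_counit. Qed.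

Lemma tri_functionalM a b : tri_functional (a * b) =
  tri_functional a * counit Fu b + counit Fu a * tri_functional b +
  ((gauss_coord (star a))^* * gauss_coord b +
   (sign_coord (star a))^* * sign_coord b).
Proof.
by rewrite /tri_functional rmorphM tri_zM -star_morphismP !tri_x_counit.
Qed.

Lemma tri_functional_scalar : scalar tri_functional.
Proof. by move=> c a b; rewrite /tri_functional linearP. Qed.

(** On the kernel of the counit the Schürmann identity leaves only a sum of two squared moduli,
    which gives positivity. *)
Lemma tri_functional_generating :
  generating_functional (counit Fu) tri_functional.
Proof.
split; first exact: tri_functional_scalar.
- by rewrite /tri_functional rmorph1.
- by move=> a; rewrite /tri_functional star_morphismP.
- move=> a a0; rewrite tri_functionalM star_morphismP a0 starK.
  rewrite mulr0 star0 mul0r !add0r.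
  by rewrite addr_ge0 // mulrC mul_conjC_ge0.
Qed.

(** Matrices of size 0 are all equal, so a non-normal [N] forces [d] to be positive. A diagonal
    generator is needed to tell [sign_char] from the counit. *)
Lemma commutant_index : 'I_d.
Proof.
case: d F N Nn => [F0 N0|d' *]; last exact: ord0.
by case; apply/matrixP => -[].
Qed.

Lemma sign_fixed0 (z : R[i]) :
  (forall a, sign_char a * z = counit Fu a * z) -> z = 0.
Proof.
move=> /(_ (u commutant_index commutant_index)).
rewrite sign_charE counitE eqxx mulN1r mul1r => /eqP.
by rewrite eq_sym -addr_eq0 -mulr2n mulrn_eq0 => /eqP.
Qed.

Lemma not_property_GC : ~ property_GC (counit Fu).
Proof.
pose eta a : 'rV[R[i]]_1 := \row_j gauss_coord a.
move=> /(_ _ eta)[|psi hpsi].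
  split=> [c a b|a b]; apply/rowP => j.
    by rewrite !mxE gauss_coord_linear.
  by rewrite !mxE gauss_coordM.
apply: Nn.
have := @completable_normal _ _ _ _ _ _ _ _ hpsi N^T.
rewrite !trmxK; apply => // j k l m.
have etaE a : eta a 0 0 = gauss_coord a by rewrite mxE.
by rewrite /inner /= /row_inner big_ord1 !etaE !gauss_coord_gen.
Qed.

Lemma not_property_NC : ~ property_NC (counit Fu).
Proof.
pose eta a : 'rV[R[i]]_1 := \row_j sign_coord a.
move=> /(_ _ (diag_rep (fun=> sign_char)) eta)[x hx||psi hpsi].
- apply/rowP => j; rewrite [RHS]mxE; apply: sign_fixed0 => a.
  by have /rowP/(_ j) := hx a; rewrite !mxE.
- split=> [c a b|a b]; apply/rowP => j.
    by rewrite !mxE sign_coord_linear.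
  by rewrite !mxE sign_coordM.
apply: Nn.
(* The transpose of this matrix is [N^*], which commutes with the Hermitian [F^* F] and is normal
   only if [N] is. *)
have := @completable_normal _ _ _ _ _ _ _ _ hpsi (N^T^t*).
rewrite map_trmx !trmxK => h.
have := h _ (hermitian_commutant (hermitian_gram F) QN).
rewrite trmxCK => -> // j k l m.
have etaE a : eta a 0 0 = sign_coord a by rewrite mxE.
by rewrite /inner /= /row_inner big_ord1 !etaE !sign_coord_gen !trmxK.
Qed.

Definition sum_char (j : 'I_2) : character A :=
  if j == 0 then counit Fu else sign_char.
Definition sum_cocycle (a : A) : 'rV[R[i]]_2 :=
  \row_j if j == 0 then gauss_coord a else sign_coord a.

Lemma sum_triple :
  schurmann_triple (counit Fu) (diag_rep sum_char) sum_cocycle tri_functional.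
Proof.
split; last 1 first.
- move=> a b; rewrite tri_functionalM /inner /= /row_inner.
  by rewrite big_ord_recl big_ord1 !mxE.
- split=> [c a b|a b]; apply/rowP => j; rewrite !mxE /sum_char; case: eqP => _.
  + exact: gauss_coord_linear.
  + exact: sign_coord_linear.
  + exact: gauss_coordM.
  + exact: sign_coordM.
exact: tri_functional_scalar.
Qed.

(** Surjectivity gives the density that makes the direct sum the associated triple of
    [tri_functional]. *)
Lemma sum_cocycle_onto x : exists a, sum_cocycle a = x.
Proof.
have [|j [k [l [m]]]] := @non_normal_independent _ _ N^T.
  move=> /(congr1 trmx); rewrite !trmx_mul !map_trmx !trmxK => h.
  exact: Nn (esym h).
rewrite -!gauss_coord_gen -!sign_coord_gen.
set p := u j k; set q := u l m => ne.
pose D := gauss_coord p * sign_coord q - gauss_coord q * sign_coord p.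
have D0 : D != 0 by rewrite subr_eq0.
(* Cramer's rule with determinant [D]; the trailing [0] gives the shape [c *: a + b] on which the
   linearity lemmas rewrite. *)
exists (((x 0 0 * sign_coord q - gauss_coord q * x 0 1) / D) *: p
  + (((gauss_coord p * x 0 1 - x 0 0 * sign_coord p) / D) *: q + 0)).
apply/rowP => i; rewrite mxE.
have zero (f : A -> R[i]) :
    (forall (c : R[i]) a b, f (c *: a + b) = c * f a + f b) -> f 0 = 0.
  by move=> h; have := h (-1) 0 0; rewrite scaler0 addr0 mulN1r addNr.
rewrite !gauss_coord_linear !sign_coord_linear.
rewrite (zero gauss_coord gauss_coord_linear).
rewrite (zero sign_coord sign_coord_linear) !addr0.
case: (i =P 0) => [->|/eqP i0]; first by rewrite /D; field; exact: D0.
have -> : i = 1 by apply/val_inj; case: i i0 => -[|[|]].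
by rewrite /D; field; exact: D0.
Qed.

Lemma not_property_LK : ~ property_LK (counit Fu).
Proof.
move=> /(_ _ tri_functional_generating _ (diag_rep sum_char) sum_cocycle)[].
  split; first exact: sum_triple.
  move=> x e e0; have [a <-] := sum_cocycle_onto x; exists a.
  by rewrite subrr hnorm_lt // /hsq inner0r exprn_gt0.
move=> psi [_ [_ _ hpsi _]]; apply: Nn.
have := @completable_normal _ _ _ _ _ _ _ _ hpsi N^T.
rewrite !trmxK; apply => // j k l m.
(* The Gaussian part of the direct sum is the first coordinate axis: on the second one the algebra
   acts by [sign_char], where [sign_fixed0] leaves only 0. Projecting thus recovers the cocycle with
   matrix [N^T], which [psi] would complete. *)
have projE a : val (cocycle_G (counit Fu) (diag_rep sum_char) sum_cocycle a) =
    \row_j if j == 0 then gauss_coord a else 0.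
  apply: proj_unique.
    apply/asboolP => b; apply/rowP => i; rewrite !mxE /sum_char.
    by case: eqP => // _; rewrite !mulr0.
  apply/asboolP => -[z /= zG]; move/asboolP: zG => zG.
  rewrite /inner /= /row_inner big_ord_recl big_ord1 !mxE /= subrr mulr0 add0r.
  rewrite (@sign_fixed0 (z 0 _)) ?rmorph0 ?mul0r // => b.
  by have /rowP/(_ (lift 0 0)) := zG b; rewrite !mxE.
rewrite -!gauss_coord_gen; move: (u j k) (u l m) => a b.
rewrite {1}/inner /= /subspace_inner !projE /inner /= /row_inner.
by rewrite big_ord_recl big_ord1 !mxE /= mulr0 addr0.
Qed.
End NonNormalCommutant.

Theorem theorem3p5 (R : realType) (d : nat) (F : 'M[R[i]]_d)
    (F_unit : F \in unitmx) (F_nongeneric : non_generic F) :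
  [/\ ~ property_GC (counit F_unit),
      ~ property_NC (counit F_unit)
    & ~ property_LK (counit F_unit)].
Proof.
have [||N [QN Nn]] := @repeated_eigenvalue_commutant _ _ (F^t* *m F).
- exact: hermitian_gram.
- by move: F_nongeneric; rewrite /non_generic map_trmx.
split; first exact: not_property_GC QN Nn.
  exact: not_property_NC QN Nn.
exact: not_property_LK QN Nn.
Qed.
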